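(* Let $\sigma>0$, $\alpha>0$, $L_n=\log(1/\Delta_n)$ and $$L_n^{\mathrm m}=\begin{pmatrix}1&0\\ \sigma L_n&1\end{pmatrix},\qquad L_n^{\mathrm o}=\begin{pmatrix}1&0&0\\ \sigma L_n&1&0\\ 0&0&1\end{pmatrix}.$$ Then $$L_n^{\mathrm m}\begin{pmatrix}S_{\sigma,n}^{\mathrm m}\\ S_{H,n}^{\mathrm m}\end{pmatrix}=\begin{pmatrix}S_{\sigma,n}^{\mathrm m}\\ R_{H,n}^{\mathrm m}\end{pmatrix},\qquad L_n^{\mathrm o}\begin{pmatrix}S_{\sigma,n}^{\mathrm o}\\ S_{H,n}^{\mathrm o}\\ S_{\alpha,n}^{\mathrm o}\end{pmatrix}=\begin{pmatrix}S_{\sigma,n}^{\mathrm o}\\ R_{H,n}^{\mathrm o}\\ S_{\alpha,n}^{\mathrm o}\end{pmatrix}.$$ Thus, at the critical boundary $H=3/4$, the explicit singular coupling in the $\sigma$-direction is removed by a single triangular transformation, and no second projection is required.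
   Context: mfBm model (superscript $\mathrm m$): $Y_t=\sigma B_t^H+W_t$, with $B^H$ a standard fractional Brownian motion of Hurst index $H$ and $W$ an independent standard Brownian motion; the data are $X_n^{\mathrm m}=(Y_{k\Delta_n}-Y_{(k-1)\Delta_n})_{k=1}^n$, centered Gaussian with covariance $\Sigma_n^{\mathrm m}(\sigma,H)$. mfOU model (superscript $\mathrm o$): $X$ is the stationary solution of $dX_t=-\alpha X_t\,dt+d(\sigma B_t^H+W_t)$; the data are $X_n^{\mathrm o}=(X_{\Delta_n},\dots,X_{n\Delta_n})^\top$, centered Gaussian with covariance $\Sigma_n^{\mathrm o}(\sigma,H,\alpha)$. Here $\Delta_n>0$ is the sampling step. For $\bullet\in\{\mathrm m,\mathrm o\}$, $S_{i,n}^\bullet$ is the partial derivative in the parameter $i$ of the Gaussian log-likelihood, evaluated at the critical point ($\vartheta_{\mathrm m}=(\sigma,3/4)$, resp. $\vartheta_{\mathrm o}=(\sigma,3/4,\alpha)$). With $\Sigma=\Sigma_n^\bullet$ at the critical point, $M_{i,n}^\bullet=\Sigma^{-1/2}(\partial_i\Sigma)\Sigma^{-1/2}$, $Z_n=\Sigma^{-1/2}X_n^\bullet$, $Q_n(A)=Z_n^\top AZ_n-\mathrm{tr}(A)$, and the transformed $H$-score is defined by $R_{H,n}^\bullet=\frac12Q_n(D_n^\bullet)$ with $D_n^\bullet=M_{H,n}^\bullet+\sigma L_nM_{\sigma,n}^\bullet$. ''No second projection is required'' refers to the fact that the limiting covariance matrix $\begin{pmatrix}9\sigma^2/16&9\sigma^3/32\\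 9\sigma^3/32&3\sigma^4/16\end{pmatrix}$ of the normalized transformed $(\sigma,H)$ scores is already non-degenerate (correlation $\sqrt3/2<1$). *)

(* Defs.v *)
From HB Require Import structures.
From mathcomp Require Import all_boot all_order all_algebra.
From mathcomp Require Import all_classical all_reals all_analysis.

Set Implicit Arguments.
Unset Strict Implicit.
Unset Printing Implicit Defensive.

Import Order.TTheory GRing.Theory Num.Theory.
Import numFieldNormedType.Exports.
Local Open Scope classical_set_scope.
Local Open Scope ring_scope.

(* All processes are indexed by real times, but only the restriction to the
   times t >= 0 is constrained. *)
Section processes.
Context {d : measure_display} {T : measurableType d} {R : realType}.
Implicit Types (P : probability T R) (B W X Y : R -> {mfun T >-> R}).

(* Laws are compared on measurable sets only. The point mass is a separate case
   because [normal_prob m 0] is not the point mass at m in the library. *)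
Definition centered_gaussian P (Z : T -> R) : Prop :=
  (exists2 s : R, 0 < s &
     forall A : set R, measurable A -> P (Z @^-1` A) = normal_prob 0 s A) \/
  (forall A : set R, measurable A -> P (Z @^-1` A) = \d_(0 : R) A).

Definition centered_gaussian_process P X : Prop :=
  forall (m : nat) (t c : 'I_m -> R), (forall i, 0 <= t i) ->
    centered_gaussian P (fun w => \sum_i c i * X (t i) w).

Definition continuous_paths X : Prop :=
  forall w, {within `[0, +oo[, continuous (fun t => X t w)}.

Definition fBm P (H : R) B : Prop :=
  [/\ centered_gaussian_process P B, continuous_paths B &
      forall s t, 0 <= s -> 0 <= t ->
        covariance P (B s) (B t)
        = ((s `^ (2 * H) + t `^ (2 * H) - `|t - s| `^ (2 * H)) / 2)%:E].

Definition brownian_motion P W : Prop :=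
  [/\ centered_gaussian_process P W, continuous_paths W &
      forall s t, 0 <= s -> 0 <= t ->
        covariance P (W s) (W t) = (Num.min s t)%:E].

Definition process_events X : set (set T) :=
  <<s [set E | exists t : R, exists A : set R,
         [/\ 0 <= t, measurable A & E = X t @^-1` A]] >>.

Definition independent_processes P X Y : Prop :=
  forall E F, process_events X E -> process_events Y F ->
    P (E `&` F) = (P E * P F)%E.

Definition driving_noise P (H : R) B W : Prop :=
  [/\ fBm P H B, brownian_motion P W & independent_processes P B W].

(* Strict stationarity; measurable rectangles determine the
   finite-dimensional laws. *)
Definition stationary P X : Prop :=
  forall (m : nat) (t : 'I_m -> R) (A : 'I_m -> set R) (h : R),
    (forall i, 0 <= t i) -> (forall i, measurable (A i)) -> 0 <= h ->
    P (\bigcap_(i in [set: 'I_m]) (X (t i + h) @^-1` A i))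
    = P (\bigcap_(i in [set: 'I_m]) (X (t i) @^-1` A i)).

Definition mfBm P (sigma H : R) Y : Prop :=
  exists B W, driving_noise P H B W /\
    forall t w, 0 <= t -> Y t w = sigma * B t w + W t w.

(* The equation dX = - alpha X dt + d(sigma B + W) is understood in its
   integrated form, almost surely for all times simultaneously. *)
Definition mfOU P (sigma H alpha : R) X : Prop :=
  exists B W,
    [/\ driving_noise P H B W, centered_gaussian_process P X,
        continuous_paths X, stationary P X &
        {ae P, forall w, forall t, 0 <= t ->
          X t w = X 0 w
                  - alpha * (\int[lebesgue_measure]_(u in `[0%R, t]) X u w)%R
                  + (sigma * B t w + W t w) - (sigma * B 0 w + W 0 w)}].

Definition cov_mx P n (U : T -> 'cV[R]_n) : 'M[R]_n :=
  \matrix_(j, k) fine (covariance P (fun w => U w j 0) (fun w => U w k 0)).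

Definition mfBm_data Y (D : R) n (w : T) : 'cV[R]_n :=
  \col_(k < n) (Y (k.+1%:R * D) w - Y (k%:R * D) w).

Definition mfOU_data X (D : R) n (w : T) : 'cV[R]_n :=
  \col_(k < n) X (k.+1%:R * D) w.

End processes.

Section gaussian_scores.
Context {R : realType} {n : nat}.

(* Logarithm of the density of N(0, S) at x. *)
Definition loglik (S : 'M[R]_n) (x : 'cV[R]_n) : R :=
  - (n%:R / 2) * ln (2 * pi) - ln (\det S) / 2
  - (x^T *m invmx S *m x) 0 0 / 2.

Definition psdmx (A : 'M[R]_n) : Prop :=
  A^T = A /\ forall x : 'cV[R]_n, 0 <= (x^T *m A *m x) 0 0.

(* The positive semidefinite square root, when there is one. *)
Definition sqrtmx (A : 'M[R]_n) : 'M[R]_n :=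
  xget 0 [set B | psdmx B /\ B *m B = A].

Definition invsqrtmx (A : 'M[R]_n) : 'M[R]_n := invmx (sqrtmx A).

Definition derivmx (F : R -> 'M[R]_n) (r : R) : 'M[R]_n :=
  \matrix_(j, k) derive1 (fun s => F s j k) r.

(* Below S is the covariance matrix as a function of (sigma, H), any further
   parameter being fixed, and x is the observed vector. *)
Implicit Types (S : R -> R -> 'M[R]_n) (x : 'cV[R]_n).

Definition score_sigma S (sigma H : R) x : R :=
  derive1 (fun s => loglik (S s H) x) sigma.

Definition score_H S (sigma H : R) x : R :=
  derive1 (fun h => loglik (S sigma h) x) H.

Definition M_sigma S (sigma H : R) : 'M[R]_n :=
  let K := invsqrtmx (S sigma H) in
  K *m derivmx (fun s => S s H) sigma *m K.

Definition M_H S (sigma H : R) : 'M[R]_n :=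
  let K := invsqrtmx (S sigma H) in
  K *m derivmx (fun h => S sigma h) H *m K.

Definition centered_quad (z : 'cV[R]_n) (A : 'M[R]_n) : R :=
  (z^T *m A *m z) 0 0 - \tr A.

Definition transformed_score_H S (sigma H l : R) x : R :=
  centered_quad (invsqrtmx (S sigma H) *m x)
    (M_H S sigma H + (sigma * l) *: M_sigma S sigma H) / 2.

End gaussian_scores.

Definition mx_of_seq {R : realType} m n (s : seq (seq R)) : 'M[R]_(m, n) :=
  \matrix_(i, j) nth 0 (nth [::] s i) j.

(* In a model, the probability measure and the observed process are given for
   each parameter value; the data are those of the critical parameter. *)
Section mfBm_model.
Context {d : measure_display} {T : measurableType d} {R : realType}.
Variables (P : R -> R -> probability T R).
Variables (Y : R -> R -> R -> {mfun T >-> R}).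
Variables (sigma D : R) (n : nat).

Definition Sigma_m (s h : R) : 'M[R]_n := cov_mx (P s h) (mfBm_data (Y s h) D n).

Definition X_m (w : T) : 'cV[R]_n := mfBm_data (Y sigma (3 / 4)) D n w.

Definition S_sigma_m (w : T) : R := score_sigma Sigma_m sigma (3 / 4) (X_m w).

Definition S_H_m (w : T) : R := score_H Sigma_m sigma (3 / 4) (X_m w).

Definition R_H_m (w : T) : R :=
  transformed_score_H Sigma_m sigma (3 / 4) (ln D^-1) (X_m w).

End mfBm_model.

Section mfOU_model.
Context {d : measure_display} {T : measurableType d} {R : realType}.
Variables (P : R -> R -> R -> probability T R).
Variables (X : R -> R -> R -> R -> {mfun T >-> R}).
Variables (sigma alpha D : R) (n : nat).

Definition Sigma_o (s h a : R) : 'M[R]_n :=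
  cov_mx (P s h a) (mfOU_data (X s h a) D n).

Definition X_o (w : T) : 'cV[R]_n := mfOU_data (X sigma (3 / 4) alpha) D n w.

Definition S_sigma_o (w : T) : R :=
  score_sigma (fun s h => Sigma_o s h alpha) sigma (3 / 4) (X_o w).

Definition S_H_o (w : T) : R :=
  score_H (fun s h => Sigma_o s h alpha) sigma (3 / 4) (X_o w).

Definition S_alpha_o (w : T) : R :=
  derive1 (fun a => loglik (Sigma_o sigma (3 / 4) a) (X_o w)) alpha.

Definition R_H_o (w : T) : R :=
  transformed_score_H (fun s h => Sigma_o s h alpha) sigma (3 / 4) (ln D^-1)
    (X_o w).

End mfOU_model.

Definition L_m {R : realType} (sigma D : R) : 'M[R]_2 :=
  mx_of_seq 2 2 [:: [:: 1; 0]; [:: sigma * ln D^-1; 1]].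

Definition L_o {R : realType} (sigma D : R) : 'M[R]_3 :=
  mx_of_seq 3 3 [:: [:: 1; 0; 0]; [:: sigma * ln D^-1; 1; 0]; [:: 0; 0; 1]].

Definition colv {R : realType} n (s : seq R) : 'cV[R]_n :=
  \col_(i < n) nth 0 s i.

Definition correlation {R : realType} (G : 'M[R]_2) : R :=
  G 0 1 / Num.sqrt (G 0 0 * G 1 1).

Definition critical_cov {R : realType} (sigma : R) : 'M[R]_2 :=
  mx_of_seq 2 2 [:: [:: 9 * sigma ^+ 2 / 16; 9 * sigma ^+ 3 / 32];
                    [:: 9 * sigma ^+ 3 / 32; 3 * sigma ^+ 4 / 16]].

(* If the covariance matrices of (U n / a n, V n / b n) converge to G, they are
   eventually invertible, with correlation converging to that of G. *)
Definition nondegenerate_under_limit {d : measure_display}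
    {T : measurableType d} {R : realType} (P : probability T R)
    (U V : nat -> T -> R) (G : 'M[R]_2) : Prop :=
  forall a b : nat -> R, (forall n, 0 < a n) -> (forall n, 0 < b n) ->
  let C n := cov_mx P (fun w => colv 2 [:: U n w / a n; V n w / b n]) in
  (forall i j, C n i j @[n --> \oo] --> G i j) ->
  (\forall n \near \oo, C n \in unitmx) /\
  correlation (C n) @[n --> \oo] --> correlation G.

(* Main.v *)
Require Import Defs.
From HB Require Import structures.
From mathcomp Require Import all_boot all_order perm all_algebra.
From mathcomp Require complex spectral.
From mathcomp Require Import all_classical all_reals all_analysis.
From mathcomp Require Import measurable_realfun.
From mathcomp Require Import ring lra zify.

(** The identity between the scores is linear algebra once the log-likelihood of
    a centered Gaussian vector has been differentiated. For a differentiable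
    family of positive definite covariance matrices [S], the derivative of the
    log-likelihood is half the centered quadratic form of the whitened vector
    [S^{-1/2} x] with matrix [S^{-1/2} (dS) S^{-1/2}] ([derive1_loglik]). This
    expression is linear in [dS], so adding [sigma * L] times the sigma-score to
    the H-score amounts to adding the corresponding matrices
    ([transformed_score_HE]). The formula needs the symmetric square root of a
    positive definite matrix, Jacobi's formula and the derivative of the inverse.

    What remains is that the covariance matrices of the two models are positive
    definite, and differentiable in sigma and in H at the critical point. In
    both models the covariance has the form [s ^+ 2 *: A h + B]
    ([regular_covariance_decomposition]), with [A] the contribution of the
    fractional noise and [B] that of the Brownian noise. Differentiability in
    sigma is clear, and positivity comes from [B] ([posdef_addl]): it is a
    multiple of the identity for the increments of the mixed fractional Brownian
    motion, and the covariance of a stationary autoregression for the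
    Ornstein-Uhlenbeck samples. For the mixed fractional Brownian motion the
    matrix [A] is an explicit combination of powers [u `^ (2 * h)].

    For the Ornstein-Uhlenbeck model the covariance has to be computed from the
    equation, whose initial value may be correlated with the future noise. Only
    the variance of the noise increments is used. Write [r] for the
    autocovariance and [J t] for the integral of the path over [0, t]. Computing
    the variance of [N t - N 0 = (X t - X 0) + alpha * J t] gives, since the cross
    term vanishes by stationarity, the equation
    [r t = r 0 - g t / 2 + alpha ^+ 2 * Phi t], where [g t] is the variance of
    [N t - N 0] and [Phi] is the second primitive of [r] ([acov_equation]). This is
    a linear differential equation of order two for [Phi]. As [r] is bounded, the
    coefficient of the growing exponential is prescribed, which also determines
    [r 0]; hence [r] is a linear functional of [g], made of integrals of [g]
    against exponentials ([bounded_solutionE]). These integrals are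
    differentiated in H under the integral sign ([derivable_kernel_powR]).

    Finally, the limiting covariance matrix has determinant
    [27 / 1024 * sigma ^+ 6] and correlation [Num.sqrt 3 / 2], and invertibility
    and correlation pass to the approximating matrices by continuity
    ([nondegenerate_of_limit]). *)

Set Implicit Arguments.
Unset Strict Implicit.
Unset Printing Implicit Defensive.

Import Order.TTheory GRing.Theory Num.Theory.
Import numFieldNormedType.Exports.
Local Open Scope classical_set_scope.
Local Open Scope ring_scope.

(** * Fourth roots of positive definite matrices *)

Section fourth_root.
Import complex spectral.
Local Close Scope classical_set_scope.

Lemma interpolation (F : fieldType) (f : F -> F) (s : seq F) :
  exists p : {poly F}, {in s, forall x, p.[x] = f x}.
Proof.
elim: s => [|a s [p pf]]; first by exists 0 => x.
have [as_|/negP ans] := boolP (a \in s).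
  by exists p => x; rewrite inE => /predU1P[->|]; exact: pf.
pose q := \prod_(b <- s) ('X - b%:P).
have qa : q.[a] != 0.
  apply/negP; rewrite -/(root q a) root_prod_XsubC; exact: ans.
exists (p + ((f a - p.[a]) / q.[a]) *: q) => x; rewrite inE => /predU1P[->|xs].
  by rewrite !hornerE divfK// addrC subrK.
rewrite !hornerE (_ : q.[x] = 0) ?mulr0 ?addr0 ?pf//.
by apply/eqP; rewrite -/(root q x) root_prod_XsubC.
Qed.

Lemma horner_mx_tr (F : comNzRingType) n (A : 'M[F]_n.+1) (p : {poly F}) :
  A^T = A -> (horner_mx A p)^T = horner_mx A p.
Proof.
move=> At; elim/poly_ind: p => [|p c IH]; first by rewrite rmorph0 trmx0.
rewrite rmorphD rmorphM/= horner_mx_X horner_mx_C linearD/= trmx_mul At IH.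
rewrite tr_scalar_mx; congr (_ + _).
exact: (esym (comm_horner_mx _ (erefl : comm_mx A A))).
Qed.

Definition posdefmx (R : numDomainType) n (A : 'M[R]_n) : Prop :=
  A^T = A /\ forall x : 'cV[R]_n, x != 0 -> 0 < (x^T *m A *m x) 0 0.

Lemma posdef_eigenvalue_gt0 (R : realFieldType) n (A : 'M[R]_n) (d : R) :
  posdefmx A -> eigenvalue A d -> 0 < d.
Proof.
move=> [_ Apos] /eigenvalueP[v vA v0].
have vt0 : v^T != 0 by rewrite trmx_eq0.
have := Apos _ vt0; rewrite trmxK vA -scalemxAl mxE.
have: 0 <= (v *m v^T) 0 0.
  by rewrite mxE sumr_ge0// => i _; rewrite mxE -expr2 sqr_ge0.
by rewrite le_eqVlt => /predU1P[<-|/pmulr_lgt0 ->//]; rewrite mulr0 ltxx.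
Qed.

(** The spectral theorem is applied to the complexification of [A]. Its
    eigenvalues are real, hence roots of the characteristic polynomial over
    [R] itself. *)
Lemma symmetric_spectral (R : rcfType) n (A : 'M[R]_n.+1) : A^T = A ->
  exists (P : 'M[R[i]]_n.+1) (d : 'I_n.+1 -> R),
    [/\ P \in unitmx,
        map_mx (real_complex R) A
        = invmx P *m diag_mx (\row_j (d j)%:C%C) *m P
      & forall j, eigenvalue A (d j)].
Proof.
move=> At; pose f := real_complex R; pose B := map_mx f A.
have Bh : B \is hermsymmx.
  apply/is_hermitianmxP; rewrite expr0 scale1r map_trmx.
  apply/matrixP => i j; rewrite !mxE; have /matrixP/(_ i j) := At.
  by rewrite mxE => ->; apply/esym/CrealP; rewrite complex_real.
have Breal := hermitian_spectral_diag_real Bh.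
have /orthomx_spectralP Beq := hermitian_normalmx Bh.
set P := spectralmx B in Beq; set D := spectral_diag B in Beq Breal.
have Pu : P \in unitmx by exact: spectral_unit.
have DE j : D 0 j = f (complex.Re (D 0 j)).
  have := mxOverP Breal 0 j; rewrite /f; case: (D 0 j) => x y.
  by rewrite complex_real/= => /eqP->.
have Drow : D = \row_j (complex.Re (D 0 j))%:C%C.
  by apply/rowP => j; rewrite mxE {1}DE.
exists P, (fun j => complex.Re (D 0 j)); split; [exact: Pu | |].
  rewrite -/f -/B -Drow; exact: Beq.
move=> j; set e := complex.Re _.
have : eigenvalue B (f e).
  apply/eigenvalueP; exists (row j P); last first.
    apply: contraTneq Pu => rowP0; rewrite unitmxE unitfE negbK.
    by rewrite (expand_det_row P j) big1// => i _; have /rowP/(_ i) := rowP0;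
      rewrite !mxE => ->; rewrite mul0r.
  rewrite Beq !mulmxA -row_mul mulmxV// row1.
  by rewrite -rowE row_diag_mx -DE -scalemxAl -rowE.
rewrite !eigenvalue_root_char /B -map_char_poly.
by rewrite fmorph_root.
Qed.

Lemma horner_mx_fixed (F : fieldType) n (A P : 'M[F]_n.+1) (D : 'rV[F]_n.+1)
    (p : {poly F}) : P \in unitmx -> A = invmx P *m diag_mx D *m P ->
  (forall j, p.[D 0 j] = D 0 j) -> horner_mx A p = A.
Proof.
move=> Pu -> pD; rewrite horner_mx_uconjC; last exact: Pu.
rewrite horner_mx_diag; congr (_ *m diag_mx _ *m _).
by apply/rowP => j; rewrite mxE pD.
Qed.

(** Let [q] be a real polynomial that takes the value of the fourth root at each
    eigenvalue of [A]. Then [q(A)] is real and symmetric by construction, and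
    its fourth power is [A] because this can be checked on the spectrum. Fourth
    roots are used instead of square roots because the square of the symmetric
    matrix [q(A)] is visibly positive semidefinite. *)
Lemma posdef_fourth_root (R : rcfType) n (A : 'M[R]_n) : posdefmx A ->
  exists C : 'M[R]_n, C^T = C /\ (C *m C) *m (C *m C) = A.
Proof.
case: n A => [|n] A Apos.
  by exists 0; split; apply/matrixP; case.
have [P [d [Pu Aeq dA]]] := symmetric_spectral Apos.1.
have d0 j : 0 <= d j by rewrite ltW// (posdef_eigenvalue_gt0 Apos).
pose r x : R := Num.sqrt (Num.sqrt x).
have [q qr] := interpolation r [seq d j | j <- enum 'I_n.+1].
exists (horner_mx A q); split; first by rewrite horner_mx_tr// Apos.1.
apply: (@map_mx_inj _ _ (real_complex R)).
rewrite -[_ *m _ *m _]/(horner_mx A q * horner_mx A q *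
  (horner_mx A q * horner_mx A q)) -!rmorphM/= map_horner_mx/=.
apply: (horner_mx_fixed Pu Aeq) => j.
have dj : d j \in [seq d k | k <- enum 'I_n.+1] by rewrite map_f ?mem_enum.
rewrite mxE horner_map !hornerM qr; last exact: dj.
suff -> : r (d j) * r (d j) * (r (d j) * r (d j)) = d j by [].
by rewrite -!expr2 -exprM (exprM _ 2 2) /r !sqr_sqrtr ?sqrtr_ge0 ?d0.
Qed.

End fourth_root.

(** * Derivatives of determinants and inverses *)

Section matrix_calculus.
Context {R : realType}.
Implicit Types (x : R).

Lemma is_derive_bigsum (I : Type) (r : seq I) (f : I -> R -> R) (df : I -> R) x :
  (forall i, is_derive x 1 (f i) (df i)) ->
  is_derive x 1 (fun s => \sum_(i <- r) f i s) (\sum_(i <- r) df i).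
Proof.
move=> fdf; elim: r => [|a r IH].
  under eq_fun do rewrite big_nil.
  by rewrite big_nil; exact: is_derive_cst.
under eq_fun do rewrite big_cons.
rewrite big_cons; exact: is_deriveD.
Qed.

Lemma is_derive_bigprod (I : eqType) (r : seq I) (f : I -> R -> R) (df : I -> R)
    x : uniq r -> (forall i, is_derive x 1 (f i) (df i)) ->
  is_derive x 1 (fun s => \prod_(i <- r) f i s)
    (\sum_(i <- r) df i * \prod_(j <- r | j != i) f j x).
Proof.
move=> + fdf; elim: r => [_|a r IH /= /andP[ar ur]].
  under eq_fun do rewrite big_nil.
  by rewrite big_nil; exact: is_derive_cst.
under eq_fun do rewrite big_cons.
have h : is_derive x 1 (f a * (fun s => \prod_(i <- r) f i s)) _ :=
  is_deriveM (fdf a) (IH ur).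
apply: is_derive_eq h _.
rewrite [RHS]big_cons big_cons/= eqxx/= /GRing.scale/= addrC; congr (_ + _).
  rewrite mulrC; congr (_ * _).
  rewrite big_seq_cond [RHS]big_seq_cond.
  by apply: eq_bigl => j; case: (boolP (j \in r)) => //= jr;
    rewrite (contraNneq _ ar)// => <-.
rewrite mulr_sumr [LHS]big_seq [RHS]big_seq; apply: eq_bigr => i ir.
rewrite big_cons (contraNneq _ ar)//; first by rewrite mulrCA.
by move=> ->.
Qed.

End matrix_calculus.

Section matrix_derivatives.
Context {R : realType}.
Implicit Types (x : R).

Lemma is_derive_near_eq (f g : R -> R) x (d : R) :
  (\near x, f x = g x) -> is_derive x 1 f d -> is_derive x 1 g d.
Proof.
move=> fg [df fd]; apply: DeriveDef.
  exact: near_eq_derivable df.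
by rewrite -fd; apply/esym/near_eq_derive.
Qed.

Definition is_derive_mx m n (S : R -> 'M[R]_(m, n)) x (dS : 'M[R]_(m, n)) : Prop :=
  forall i j, is_derive x 1 (fun s => S s i j) (dS i j).

(** Jacobi's formula. Differentiating the Leibniz expansion replaces one row at a
    time by its derivative; expanding along that row produces the cofactors of
    [S x]. *)
Lemma is_derive_det n (S : R -> 'M[R]_n) x (dS : 'M[R]_n) :
  is_derive_mx S x dS ->
  is_derive x 1 (fun s => \det (S s)) (\tr (dS *m \adj (S x))).
Proof.
move=> SdS.
have dprod (sg : 'S_n) := is_derive_bigprod (index_enum_uniq 'I_n)
  (fun i => SdS i (sg i)).
have dterm (sg : 'S_n) : is_derive x 1
    (fun s => (-1) ^+ sg * \prod_i S s i (sg i))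
    ((-1) ^+ sg * \sum_i (dS i (sg i) * \prod_(j | j != i) S x j (sg j))).
  have := is_deriveZ ((-1) ^+ sg) (dprod sg); exact.
apply: is_derive_eq (is_derive_bigsum _ dterm) _.
pose A (i : 'I_n) : 'M[R]_n := \matrix_(k, l) if k == i then dS k l else S x k l.
transitivity (\sum_i \det (A i)).
  under eq_bigr do rewrite mulr_sumr.
  rewrite exchange_big/=; apply: eq_bigr => i _; apply: eq_bigr => sg _.
  congr (_ * _); rewrite [RHS](bigD1 i)//= !mxE eqxx; congr (_ * _).
  by apply: eq_bigr => j /negbTE ji; rewrite mxE ji.
rewrite /mxtrace; apply: eq_bigr => i _.
rewrite (expand_det_row _ i) mxE; apply: eq_bigr => j _.
rewrite !mxE eqxx /cofactor; congr (_ * (_ * \det _)).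
by apply/matrixP => k l; rewrite !mxE eq_sym (negbTE (neq_lift _ _)).
Qed.

Lemma is_derive_mulmx m n p (S : R -> 'M[R]_(m, n)) (T : R -> 'M[R]_(n, p)) x dS dT :
  is_derive_mx S x dS -> is_derive_mx T x dT ->
  is_derive_mx (fun s => S s *m T s) x (dS *m T x + S x *m dT).
Proof.
move=> SdS TdT i j; under eq_fun do rewrite mxE.
have h k : is_derive x 1 (fun s => S s i k * T s k j) _ :=
  is_deriveM (SdS i k) (TdT k j).
apply: is_derive_eq (is_derive_bigsum _ h) _.
rewrite !mxE -big_split/=; apply: eq_bigr => k _.
by rewrite /GRing.scale/= addrC; congr (_ + _); rewrite mulrC.
Qed.

Lemma is_derive_cst_mx m n (A : 'M[R]_(m, n)) x : is_derive_mx (fun=> A) x 0.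
Proof. by move=> i j; rewrite mxE; exact: is_derive_cst. Qed.

Lemma is_derive_mx_unique m n (S : R -> 'M[R]_(m, n)) x dS dS' :
  is_derive_mx S x dS -> is_derive_mx S x dS' -> dS = dS'.
Proof.
move=> h h'; apply/matrixP => i j.
by have [_ <-] := h i j; have [_ <-] := h' i j.
Qed.

Lemma near_unitmx n (S : R -> 'M[R]_n) x dS : is_derive_mx S x dS ->
  S x \in unitmx -> \forall s \near x, S s \in unitmx.
Proof.
move=> /is_derive_det[dS' _]; rewrite unitmxE unitfE => Sx0.
have cdet : {for x, continuous (fun s => \det (S s))}.
  exact/differentiable_continuous/derivable1_diffP.
near=> s; rewrite unitmxE unitfE.
near: s; apply: (cdet [set d | d != 0]).
exact: open_neq.
Unshelve. all: by end_near. Qed.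

(** Cramer's rule shows that the entries of the inverse are differentiable; the
    value of the derivative then comes from differentiating
    [S s *m invmx (S s) = 1]. *)
Lemma is_derive_invmx n (S : R -> 'M[R]_n) x dS : is_derive_mx S x dS ->
  S x \in unitmx ->
  is_derive_mx (fun s => invmx (S s)) x (- (invmx (S x) *m dS *m invmx (S x))).
Proof.
move=> SdS Sxu; have Snear := near_unitmx SdS Sxu.
have dTij i j : derivable (fun s => invmx (S s) i j) x 1.
  apply: (@near_eq_derivable _ _ _
    (fun s => (\det (S s))^-1 * cofactor (S s) j i)).
    by near=> s; rewrite /invmx (near Snear s)// !mxE.
  apply: derivableM.
    apply: derivableV; last by have [] := is_derive_det SdS.
    by rewrite -unitfE -unitmxE.
  apply: derivableM; first exact: derivable_cst.
  have : is_derive_mx (fun s => row' j (col' i (S s))) x (row' j (col' i dS)).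
    move=> k l; rewrite !mxE.
    by under eq_fun do rewrite !mxE; exact: SdS.
  by move=> /is_derive_det[].
pose dT := \matrix_(i, j) 'D_1 (fun s => invmx (S s) i j) x.
have TdT : is_derive_mx (fun s => invmx (S s)) x dT.
  by move=> i j; apply: DeriveDef; [exact: dTij | rewrite mxE].
have /is_derive_mx_unique/(_ (is_derive_cst_mx 1%:M x)) :
    is_derive_mx (fun=> 1%:M) x (dS *m invmx (S x) + S x *m dT).
  move=> i j; apply: is_derive_near_eq (is_derive_mulmx SdS TdT i j).
  by near=> s; rewrite mulmxV//; exact: (near Snear s).
move/eqP; rewrite addr_eq0 => /eqP/(congr1 (mulmx (invmx (S x)))).
by rewrite mulmxN mulKmx// mulmxA => ->; rewrite opprK.
Unshelve. all: by end_near. Qed.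

End matrix_derivatives.

(** * The score of a Gaussian vector *)

Section gaussian_score.
Context {R : realType} {n : nat}.
Implicit Types (A B C : 'M[R]_n) (x : 'cV[R]_n).

Lemma posdef_unitmx A : posdefmx A -> A \in unitmx.
Proof.
move=> [At Apos]; rewrite unitmxE unitfE; apply/negP => /det0P[v v0 vA].
have := Apos v^T; rewrite trmx_eq0 => /(_ v0).
by rewrite trmxK vA mul0mx mxE ltxx.
Qed.

Lemma posdef_det_gt0 A : posdefmx A -> 0 < \det A.
Proof.
move=> Apos; have := posdef_unitmx Apos; rewrite unitmxE unitfE lt_def => ->/=.
by have [C [_ <-]] := posdef_fourth_root Apos; rewrite det_mulmx -expr2 sqr_ge0.
Qed.

Lemma sqrtmxP A : posdefmx A -> psdmx (sqrtmx A) /\ sqrtmx A *m sqrtmx A = A.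
Proof.
move=> Apos; rewrite /sqrtmx; apply: (@xgetPex _ 0 [set B | psdmx B /\ B *m B = A]).
have [C [Ct CA]] := posdef_fourth_root Apos; exists (C *m C); split => //.
split=> [|x]; first by rewrite trmx_mul Ct.
rewrite mulmxA -{1}Ct -trmx_mul -mulmxA mxE.
by rewrite sumr_ge0// => i _; rewrite mxE -expr2 sqr_ge0.
Qed.

Lemma invsqrtmxP A : posdefmx A ->
  (invsqrtmx A)^T = invsqrtmx A /\ invsqrtmx A *m invsqrtmx A = invmx A.
Proof.
move=> Apos; have [[Bt _] BA] := sqrtmxP Apos.
have Au := posdef_unitmx Apos.
have Bu : sqrtmx A \in unitmx.
  by move: Au; rewrite -{1}BA unitmx_mul => /andP[].
split; first by rewrite /invsqrtmx trmx_inv Bt.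
apply: (can_inj (mulmxK Au)); rewrite mulVmx// -[X in _ *m X]BA.
by rewrite !mulmxA mulmxKV// mulVmx.
Qed.

Lemma centered_quad_whitened A dA x : posdefmx A ->
  let K := invsqrtmx A in
  centered_quad (K *m x) (K *m dA *m K)
  = (x^T *m (invmx A *m dA *m invmx A) *m x) 0 0 - \tr (dA *m invmx A).
Proof.
move=> /invsqrtmxP[Kt KK] K; rewrite -/K in Kt KK.
rewrite /centered_quad -KK; congr (_ 0 0 - _).
  by rewrite trmx_mul Kt !mulmxA.
by rewrite -mulmxA mxtrace_mulC mulmxA.
Qed.

(** The derivative of [ln (det S)] is the trace of [S^-1 dS], and the derivative of
    [S^-1] is [- S^-1 dS S^-1]. Splitting [S^-1] as the square of its symmetric
    root turns the quadratic form in [x] into one in the whitened vector, and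
    leaves the trace unchanged by cyclicity. *)
Lemma derive1_loglik (S : R -> 'M[R]_n) (r : R) (dS : 'M[R]_n) x :
  is_derive_mx S r dS -> posdefmx (S r) ->
  derive1 (fun s => loglik (S s) x) r
  = centered_quad (invsqrtmx (S r) *m x)
      (invsqrtmx (S r) *m derivmx S r *m invsqrtmx (S r)) / 2.
Proof.
move=> SdS Spos; have Su := posdef_unitmx Spos; have dS0 := posdef_det_gt0 Spos.
have -> : derivmx S r = dS.
  by apply/matrixP => i j; rewrite mxE derive1E; have [_ ->] := SdS i j.
rewrite centered_quad_whitened//.
have dln : is_derive r 1 (fun s => ln (\det (S s))) (\tr (dS *m invmx (S r))).
  have := is_derive1_comp (is_derive1_ln dS0) (is_derive_det SdS).
  move/is_derive_eq; apply; rewrite /invmx Su -scalemxAr mxtraceZ.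
  by rewrite /GRing.scale/= mulrC.
have dq : is_derive r 1 (fun s => (x^T *m invmx (S s) *m x) 0 0)
    (- (x^T *m (invmx (S r) *m dS *m invmx (S r)) *m x) 0 0).
  have := is_derive_mulmx (is_derive_mulmx (is_derive_cst_mx x^T r)
    (is_derive_invmx SdS Su)) (is_derive_cst_mx x r).
  move=> /(_ 0 0)/is_derive_eq; apply.
  by rewrite mul0mx add0r mulmx0 addr0 mulmxN mulNmx mxE.
have := is_deriveB (is_deriveB (is_derive_cst (- (n%:R / 2) * ln (2 * pi)) r 1)
  (is_deriveZ 2^-1 dln)) (is_deriveZ 2^-1 dq).
set f := (X in is_derive _ _ X _) => dl.
rewrite derive1E (_ : (fun s => _) = f); last first.
  by apply/funext => s; rewrite /loglik /f !fctE /GRing.scale/= ![_ / 2]mulrC.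
have [_ ->] := dl; rewrite /GRing.scale/=; lra.
Qed.

End gaussian_score.

(** * The triangular transformation and the limiting covariance *)

Section transformed_score.
Context {R : realType} {n : nat}.
Implicit Types (S : R -> R -> 'M[R]_n) (x : 'cV[R]_n).

(** The conditions under which the two scores are given by [derive1_loglik]. *)
Definition regular_covariance S (sigma H : R) : Prop :=
  [/\ exists dS, is_derive_mx (fun s => S s H) sigma dS,
      exists dS, is_derive_mx (fun h => S sigma h) H dS &
      posdefmx (S sigma H)].

Lemma centered_quad_linear (z : 'cV[R]_n) (A B : 'M[R]_n) (c : R) :
  centered_quad z (A + c *: B) = centered_quad z A + c * centered_quad z B.
Proof.
rewrite /centered_quad mulmxDr mulmxDl -scalemxAr -scalemxAl.
rewrite mxtraceD mxtraceZ; move: (z^T *m A *m z) (z^T *m B *m z) => U V.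
by rewrite !mxE; ring.
Qed.

(** Both scores are half the centered quadratic form of the same whitened vector,
    and that form is linear in its matrix. *)
Lemma transformed_score_HE S sigma H l x : regular_covariance S sigma H ->
  transformed_score_H S sigma H l x
  = sigma * l * score_sigma S sigma H x + score_H S sigma H x.
Proof.
move=> [[dS1 S1] [dS2 S2] Spos].
rewrite /score_sigma (derive1_loglik x S1 Spos) /score_H (derive1_loglik x S2 Spos).
rewrite /transformed_score_H centered_quad_linear /M_H /M_sigma.
by rewrite mulrDl addrC -mulrA.
Qed.

Lemma L_m_colv (sigma D a b : R) :
  L_m sigma D *m colv 2 [:: a; b] = colv 2 [:: a; sigma * ln D^-1 * a + b].
Proof.
apply/matrixP => i j; rewrite !mxE !big_ord_recl big_ord0 !mxE.
by case: i => [[|[|//]]] /= ?; ring.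
Qed.

Lemma L_o_colv (sigma D a b c : R) :
  L_o sigma D *m colv 3 [:: a; b; c]
  = colv 3 [:: a; sigma * ln D^-1 * a + b; c].
Proof.
apply/matrixP => i j; rewrite !mxE !big_ord_recl big_ord0 !mxE.
by case: i => [[|[|[|//]]]] /= ?; ring.
Qed.

End transformed_score.

Section critical_covariance.
Context {R : realType}.
Implicit Types (sigma : R) (G : 'M[R]_2).

Lemma det_mx22 G : \det G = G 0 0 * G 1 1 - G 0 1 * G 1 0.
Proof.
rewrite (expand_det_row _ 0) !big_ord_recl big_ord0 /cofactor !det_mx11 !mxE/=.
rewrite addr0 expr0 expr1 mul1r mulN1r mulrN.
by congr (G _ _ * G _ _ - G _ _ * G _ _); apply/val_inj.
Qed.

Lemma det_critical_cov sigma :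
  \det (critical_cov sigma) = 27 / 1024 * sigma ^+ 6.
Proof. by rewrite det_mx22 !mxE/=; field. Qed.

Lemma critical_cov_unitmx sigma : 0 < sigma -> critical_cov sigma \in unitmx.
Proof.
move=> s0; rewrite unitmxE unitfE det_critical_cov.
by apply/lt0r_neq0/mulr_gt0; [lra | exact: exprn_gt0].
Qed.

Lemma correlation_critical_cov sigma : 0 < sigma ->
  correlation (critical_cov sigma) = Num.sqrt 3 / 2.
Proof.
move=> s0; rewrite /correlation !mxE/=.
have s3 : Num.sqrt 3 * Num.sqrt 3 = 3 :> R by rewrite -expr2 sqr_sqrtr//; lra.
have s30 : 0 < Num.sqrt 3 :> R by rewrite sqrtr_gt0; lra.
rewrite (_ : _ / 16 * _ = (3 * Num.sqrt 3 / 16 * sigma ^+ 3) ^+ 2); last first.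
  by rewrite exprMn exprMn exprMn [Num.sqrt 3 ^+ 2]expr2 s3; field.
have k0 : 0 < 3 * Num.sqrt 3 / 16 * sigma ^+ 3.
  by apply: mulr_gt0; [lra | exact: exprn_gt0].
rewrite sqrtr_sqr gtr0_norm//; apply: (mulIf (lt0r_neq0 k0)).
rewrite divfK ?lt0r_neq0//.
rewrite [RHS](_ : _ = 3 / 32 * sigma ^+ 3 * (Num.sqrt 3 * Num.sqrt 3)).
  by rewrite s3; field.
by field.
Qed.

Lemma sqrt3_half_lt1 : Num.sqrt 3 / 2 < 1 :> R.
Proof.
rewrite ltr_pdivrMr// mul1r -[ltRHS]ger0_norm// -sqrtr_sqr ltr_sqrt; lra.
Qed.

(** At an invertible matrix with positive diagonal, the determinant and the
    correlation are continuous functions of the entries. *)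
Lemma nondegenerate_of_limit d (T : measurableType d) (P : probability T R)
    (U V : nat -> T -> R) G :
  G \in unitmx -> 0 < G 0 0 * G 1 1 -> nondegenerate_under_limit P U V G.
Proof.
move=> Gu G0 a b _ _ C CG; split.
  have : \det (C n) @[n --> \oo] --> \det G.
    rewrite det_mx22; under eq_cvg do rewrite det_mx22.
    by apply: cvgB; apply: cvgM; exact: CG.
  move: Gu; rewrite unitmxE unitfE => Gn0 detC.
  apply: filterS (cvgr_neq0 _ detC Gn0) => n.
  by rewrite unitmxE unitfE.
rewrite /correlation; apply: cvgM; first exact: CG.
apply: cvgV; first by rewrite gt_eqF// sqrtr_gt0.
apply: (@cvg_comp _ _ _ (fun n => C n 0 0 * C n 1 1) Num.sqrt).
  by apply: cvgM; exact: CG.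
exact: sqrt_continuous.
Qed.

End critical_covariance.

(** * Criteria of positive definiteness *)

Section positive_definite.
Context {R : realType}.

(** Dividing by [s ^+ 2] and letting [s] tend to infinity shows that [A] is positive
    semidefinite; [B] then provides definiteness. The positivity of the
    covariances for all [s] thus replaces a proof that [A] is itself a
    covariance matrix. *)
Lemma posdef_addl n (A B : 'M[R]_n) (sigma : R) : A^T = A -> posdefmx B ->
  (forall s (x : 'cV[R]_n), 0 < s -> 0 <= (x^T *m (s ^+ 2 *: A + B) *m x) 0 0) ->
  posdefmx (sigma ^+ 2 *: A + B).
Proof.
move=> At [Bt Bpos] ABpsd.
split=> [|x x0]; first by rewrite linearD linearZ/= At Bt.
have formE s : (x^T *m (s ^+ 2 *: A + B) *m x) 0 0
    = s ^+ 2 * (x^T *m A *m x) 0 0 + (x^T *m B *m x) 0 0.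
  rewrite mulmxDr mulmxDl -scalemxAr -scalemxAl.
  by move: (x^T *m A *m x) (x^T *m B *m x) => U V; rewrite !mxE.
have := Bpos x x0; have := fun s => ABpsd s x; rewrite formE.
set a := (x^T *m A *m x) 0 0; set b := (x^T *m B *m x) 0 0 => ab b0.
suff a0 : 0 <= a by rewrite ltr_wpDl// mulr_ge0// sqr_ge0.
rewrite leNgt; apply/negP => a0.
have ba : 0 < b / - a by rewrite divr_gt0// oppr_gt0.
(* the value of s is chosen so that s ^+ 2 * a + b <= s * a + b = a *)
have := ab (1 + b / - a); rewrite formE -/a -/b addr_gt0// => /(_ isT).
rewrite leNgt => /negP; apply.
have sa : (1 + b / - a) * a + b = a by field; rewrite lt_eqF.
have s1 : 1 <= 1 + b / - a by rewrite lerDl ltW.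
apply: (le_lt_trans _ a0); rewrite -[leRHS]sa lerD2r.
apply: ler_wnM2r; first exact: ltW.
by rewrite expr2 ler_peMr // (le_trans ler01).
Qed.

Section ar1.
Variables (n : nat) (rho : R).
Hypothesis rho01 : 0 <= rho < 1.

Let L : 'M[R]_n :=
  \matrix_(j, i) if (i <= j)%N then rho ^+ (j - i) else 0.

Let innov (i : nat) : R := if i == 0%N then 1 else 1 - rho ^+ 2.

Let innov_gt0 i : 0 < innov i.
Proof.
rewrite /innov; case: ifP => // _; have /andP[r0 r1] := rho01.
by rewrite subr_gt0 expr_lt1.
Qed.

Let sum_innov (j k m : nat) : (m <= j)%N -> (m <= k)%N ->
  \sum_(i < m.+1) innov i * rho ^+ (j - i) * rho ^+ (k - i)
  = rho ^+ (j - m) * rho ^+ (k - m).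
Proof.
elim: m => [|m IH] mj mk; first by rewrite big_ord1 /innov eqxx mul1r !subn0.
rewrite big_ord_recr/= IH ?(ltnW mj) ?(ltnW mk)// /innov/=.
rewrite -(subnSK mj) -(subnSK mk) !exprS; ring.
Qed.

(** This is the covariance matrix of a stationary autoregression of order one. It
    factors as [L D L^T], where [L] is unit triangular and [D] carries the
    variances of the innovations. *)
Lemma posdef_ar1 :
  posdefmx (\matrix_(j < n, k < n) rho ^+ ((j - k) + (k - j)) : 'M[R]_n).
Proof.
split=> [|x x0]; first by apply/matrixP => j k; rewrite !mxE addnC.
have -> : (\matrix_(j < n, k < n) rho ^+ ((j - k) + (k - j)) : 'M[R]_n)
    = L *m diag_mx (\row_i innov i) *m L^T.
  apply/matrixP => j k; rewrite mxE.
  have [mn mj mk] : [/\ (minn j k < n)%N, (minn j k <= j)%N & (minn j k <= k)%N].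
    by rewrite geq_minl geq_minr (leq_ltn_trans (geq_minl _ _)).
  transitivity (rho ^+ (j - minn j k) * rho ^+ (k - minn j k)).
    rewrite -exprD; congr (_ ^+ _).
    by lia.
  rewrite -sum_innov// mxE.
  rewrite (big_ord_widen n (fun i => innov i * rho ^+ (j - i) * rho ^+ (k - i)))//.
  rewrite big_mkcond/=; apply: eq_bigr => i _; rewrite ltnS leq_min.
  rewrite mul_mx_diag !mxE; case: (leqP i j) => ij; case: (leqP i k) => ik;
    rewrite /= ?mulr0 ?mul0r//.
  by ring.
have Lu : L \in unitmx.
  rewrite unitmxE det_trig; last first.
    by apply/is_trig_mxP => i j ij; rewrite mxE leqNgt ij.
  by rewrite big1 ?unitr1// => i _; rewrite mxE leqnn subnn.
have y0 : L^T *m x != 0.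
  apply: contra_neq x0 => /(congr1 (mulmx (invmx L^T))).
  by rewrite mulKmx ?unitmx_tr// mulmx0.
rewrite !mulmxA -[x^T *m L]trmxK trmx_mul trmxK -mulmxA.
move: y0; move: (L^T *m x) => y y0.
rewrite mul_mx_diag mxE.
have term_ge0 i : 0 <= (\matrix_(i, j) (y^T i j * (\row_i innov i) 0 j)) 0 i * y i 0.
  by rewrite !mxE mulrAC -expr2 mulr_ge0 ?sqr_ge0// ltW.
have [i yi0] : exists i, y i 0 != 0.
  apply: contrapT => /forallNP y00; case/negP: y0; apply/eqP/colP => i.
  by rewrite mxE; apply: contrapT => /eqP/y00.
rewrite (bigD1 i)//= ltr_pwDl ?sumr_ge0//.
by rewrite !mxE mulrAC -expr2 mulr_gt0// lt_def sqr_ge0 sqrf_eq0 yi0.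
Qed.

End ar1.

End positive_definite.

(** * Weighted integrals of powers as functions of the exponent *)

Section power_kernels.
Context {R : realType}.
Local Notation mu := (@lebesgue_measure R).

Lemma integrable_expR (b : R) : 0 < b ->
  mu.-integrable `[0, +oo[ (EFin \o (fun u => expR (- b * u))).
Proof.
move=> b0.
have : mu.-integrable `[0, +oo[ (EFin \o exponential_pdf b).
  by apply: integrableS (integrable_exponential_pdf b0).
move=> iexp; apply: (@eq_integrable _ _ _ mu _ _
  (fun u => b^-1%:E * (EFin \o exponential_pdf b) u)%E) => //; last first.
  exact: integrableZl.
move=> u; rewrite inE/= in_itv/= andbT => u0.
by rewrite /= exponential_pdfE// -EFinM mulKf// gt_eqF.
Qed.

Lemma is_derive_powR_exponent (u h : R) : 0 <= u -> 0 < h ->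
  is_derive h 1 (fun x => u `^ (2 * x)) (2 * ln u * u `^ (2 * h)).
Proof.
rewrite le_eqVlt => /predU1P[<-|u0] h0.
  rewrite powR0 ?mulf_neq0 ?gt_eqF// mulr0.
  apply: (@is_derive_near_eq _ (cst 0)).
  near=> x; rewrite powR0// mulf_neq0// gt_eqF//.
  by near: x; exact: lt_nbhsr.
rewrite (_ : (fun x => _) = fun x => expR (2 * x * ln u)); last first.
  by apply/funext => x; rewrite /powR gt_eqF.
rewrite /powR gt_eqF//; apply: is_derive_eq.
by rewrite /GRing.scale/= mulr1; ring.
Unshelve. all: by end_near. Qed.

(** The bound of the derivative is uniform in [h] up to [u = 0]: for [u <= 1] the
    power is at most [u], which absorbs the logarithm. *)
Lemma powR_exponent_bounds (u h : R) : 0 <= u -> 1 / 2 <= h <= 1 ->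
  `|u `^ (2 * h)| <= 1 + u ^+ 3 /\
  `|2 * ln u * u `^ (2 * h)| <= 2 * (1 + u ^+ 3).
Proof.
move=> u0 /andP[h1 h2]; have p0 := powR_ge0 u (2 * h).
have [->|un0] := eqVneq u 0.
  rewrite powR0; last by apply/lt0r_neq0; lra.
  by rewrite mulr0 normr0 expr0n/= addr0; split; lra.
have {u0 un0}u0 : 0 < u by rewrite lt_def un0.
rewrite ger0_norm// normrM normrM (ger0_norm p0) ger0_norm//.
have [u1|/ltW u1] := leP u 1.
  have u01 : 0 < u <= 1 by rewrite u0.
  have pu : u `^ (2 * h) <= u by apply: ge1r_powR => //; lra.
  have u3 : 0 <= u ^+ 3 by rewrite exprn_ge0// ltW.
  split; first lra.
  rewrite -mulrA ler_pM2l//.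
  apply: (@le_trans _ _ (`|ln u| * u)); first by rewrite ler_wpM2l.
  have : ln u^-1 <= u^-1 - 1.
    have := @le_ln1Dx _ (u^-1 - 1); rewrite [1 + _]addrC subrK; apply.
    by rewrite ltrBrDr addNr invr_gt0.
  rewrite lnV// => lnu; rewrite ler0_norm ?ln_le0//.
  have : - ln u * u <= (u^-1 - 1) * u by rewrite ler_wpM2r// ltW.
  rewrite mulrBl mulVf ?gt_eqF// mul1r; lra.
have pu : u `^ (2 * h) <= u ^+ 2.
  by rewrite -powR_mulrn ?(ltW u0)//; apply: ler_powR => //; lra.
have u23 : u ^+ 2 <= u ^+ 3 by rewrite ler_weXn2l.
split; first lra.
rewrite -mulrA ler_pM2l//.
have lnu : `|ln u| <= u.
  rewrite ger0_norm ?ln_ge0//.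
  have := @le_ln1Dx _ (u - 1); rewrite [1 + _]addrC subrK => lnu.
  apply: (le_trans (lnu _)); lra.
apply: (@le_trans _ _ (u * u ^+ 2)); first by rewrite ler_pM.
by rewrite -exprS lerDr.
Qed.

Lemma cube_le_expR (b u : R) : 0 < b -> 0 <= u ->
  (1 + u ^+ 3) * expR (- b * u)
  <= (1 + 48 / b ^+ 3) * expR (- (b / 2) * u).
Proof.
move=> b0 u0.
have -> : - b * u = - (b / 2) * u - b * u / 2 by field.
rewrite expRD mulrCA [leRHS]mulrC ler_wpM2l ?expR_ge0//.
rewrite expRN ler_pdivrMr ?expR_gt0//.
have bu0 : 0 <= b * u / 2 by rewrite divr_ge0// mulr_ge0// ltW.
have := expR_ge1Dxn 2 bu0; rewrite (_ : 3`! = 6)%N//.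
rewrite (_ : (b * u / 2) ^+ 3 / 6%:R = b ^+ 3 / 48 * u ^+ 3); last by field.
have b30 : 0 < b ^+ 3 by rewrite exprn_gt0.
move=> e; apply: (@le_trans _ _ ((1 + 48 / b ^+ 3) * (1 + b ^+ 3 / 48 * u ^+ 3))).
  rewrite (_ : (1 + 48 / _) * _ = 1 + u ^+ 3 + (48 / b ^+ 3 + b ^+ 3 / 48 * u ^+ 3)).
    have ? : 0 <= 48 / b ^+ 3 by rewrite divr_ge0// ltW.
    have ? : 0 <= b ^+ 3 / 48 * u ^+ 3.
      by rewrite mulr_ge0 ?exprn_ge0// divr_ge0// ltW.
    by rewrite lerDl addr_ge0.
  by field; rewrite gt_eqF.
by rewrite ler_wpM2l// addr_ge0// divr_ge0// ltW.
Qed.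

Section kernel.
Variables (D : set R) (w : R -> R) (C b : R).
Hypotheses (mD : measurable D) (D0 : D `<=` `[0, +oo[).
Hypotheses (mw : measurable_fun D w) (b0 : 0 < b).
Hypothesis wC : forall u, D u -> `|w u| <= C * expR (- b * u).

Let G (u : R) := 2 * C * (1 + 48 / b ^+ 3) * expR (- (b / 2) * u).

Let C0 u : D u -> 0 <= C.
Proof.
move=> /wC h; have := le_trans (normr_ge0 _) h.
by rewrite pmulr_lge0// expR_gt0.
Qed.

Let w_le_G u v : D u -> `|v| <= 2 * (1 + u ^+ 3) -> `|w u * v| <= G u.
Proof.
move=> Du v2; rewrite normrM.
have u0 : 0 <= u by have := D0 Du; rewrite /= in_itv/= andbT.
apply: (le_trans (ler_pM _ _ (wC Du) v2)) => //.
rewrite /G (_ : C * _ * _ = 2 * C * ((1 + u ^+ 3) * expR (- b * u))); last by ring.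
rewrite -[leRHS]mulrA ler_wpM2l ?mulr_ge0 ?(C0 Du)//; exact: cube_le_expR.
Qed.

Let intG : mu.-integrable D (EFin \o G).
Proof.
have b20 : 0 < b / 2 by rewrite divr_gt0.
apply: (@integrableS _ _ _ mu `[0, +oo[) => //.
apply: (@eq_integrable _ _ _ mu _ _ (fun u => (2 * C * (1 + 48 / b ^+ 3))%:E
  * (EFin \o (fun u => expR (- (b / 2) * u))) u)%E) => //.
by apply: integrableZl => //; exact: integrable_expR.
Qed.

Let mpowR (p : R) : measurable_fun D (fun u => u `^ p).
Proof. by apply: measurable_funTS; exact: measurable_powR. Qed.

Lemma integrable_kernel_powR h : 1 / 2 <= h <= 1 ->
  mu.-integrable D (EFin \o (fun u => w u * u `^ (2 * h))).
Proof.
move=> h12; apply: le_integrable intG => //=.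
  by apply/measurable_EFinP; apply: measurable_funM; [exact: mw|exact: mpowR].
move=> u Du; rewrite lee_fin.
have u0 : 0 <= u by have := D0 Du; rewrite /= in_itv/= andbT.
have [ub _] := powR_exponent_bounds u0 h12.
apply: (le_trans _ (ler_norm _)); apply: w_le_G => //.
have := le_trans (normr_ge0 _) ub; lra.
Qed.

(** The derivative of the integrand is dominated, uniformly in the exponent, by a
    multiple of [expR (- (b / 2) * u)]. *)
Lemma derivable_kernel_powR (h : R) : 1 / 2 < h < 1 ->
  derivable (fun x : R => \int[mu]_(u in D) (w u * u `^ (2 * x)) : R) h 1.
Proof.
move=> h12.
have df (x u : R) : D u -> 1 / 2 < x < 1 ->
    is_derive x 1 (fun y => w u * u `^ (2 * y)) (w u * (2 * ln u * u `^ (2 * x))).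
  move=> Du /andP[x1 _].
  have u0 : 0 <= u by have := D0 Du; rewrite /= in_itv/= andbT.
  have x0 : 0 < x by lra.
  have := is_deriveZ (w u) (is_derive_powR_exponent u0 x0); exact.
apply: (@derivable_under_integral _ _ _ mu
  (fun x u => w u * u `^ (2 * x)) D mD h (1 / 2) 1 _ _ _ (fun u => `|G u|)).
- by rewrite /= in_itv.
- move=> x; rewrite /= in_itv/= => /andP[x1 x2].
  by apply: integrable_kernel_powR; rewrite !ltW.
- by move=> x u; rewrite /= in_itv/= => x12 Du; have [] := df x u Du x12.
- by [].
- exact: integrable_norm intG.
- move=> x u; rewrite /= in_itv/= => x12 Du; rewrite partial1of2E.
  have [_ ->] := df x u Du x12; apply: (le_trans _ (ler_norm _)).
  apply: w_le_G => //.
  have u0 : 0 <= u by have := D0 Du; rewrite /= in_itv/= andbT.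
  have x12' : 1 / 2 <= x <= 1 by case/andP: x12 => x1 x2; rewrite !ltW.
  by have [_] := powR_exponent_bounds u0 x12'.
Qed.

End kernel.

End power_kernels.

(** * The integral equation of a stationary covariance *)

Section bounded_solution.
Context {R : realType}.

Lemma continuous_expRM (b : R) : continuous (fun t : R => expR (b * t)).
Proof.
move=> t; apply: differentiable_continuous; apply/derivable1_diffP.
exact: ex_derive.
Qed.

Local Notation mu := (@lebesgue_measure R).

(** The covariance at lag [t] of the stationary solution of
    [dX = - a X dt + dN], when the noise [N] has stationary increments and
    [p t] is the variance of [N t - N 0]. *)
Definition langevin_cov (a : R) (p : R -> R) (t : R) : R :=
  a / 4 * (expR (a * t) + expR (- a * t))
    * \int[mu]_(u in `[0, +oo[) (expR (- a * u) * p u)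
  - p t / 2
  - a / 4 * (expR (a * t) * \int[mu]_(u in `[0, t]) (expR (- a * u) * p u)
             - expR (- a * t) * \int[mu]_(u in `[0, t]) (expR (a * u) * p u)).

Variables (a : R) (g r phi Phi : R -> R) (K : R).
Hypothesis a0 : 0 < a.
Hypothesis gc : {within `[0, +oo[, continuous g}.
Hypothesis g0 : forall t : R, 0 <= t -> 0 <= g t.
Hypothesis dPhi : forall t : R, 0 < t -> is_derive t 1 Phi (phi t).
Hypothesis dphi : forall t : R, 0 < t -> is_derive t 1 phi (r t).
Hypothesis Phi0 : Phi t @[t --> 0^'+] --> 0.
Hypothesis phi0 : phi t @[t --> 0^'+] --> 0.
Hypothesis PhiK : forall t : R, 0 <= t -> `|phi t + a * Phi t| <= K * (1 + t ^+ 3).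
Hypothesis rE : forall t : R, 0 <= t -> r t = r 0 - g t / 2 + a ^+ 2 * Phi t.
Hypothesis Phi00 : Phi 0 = 0.
Hypothesis phi00 : phi 0 = 0.

(* Since Phi'' = r, the equation reads Phi'' = a ^ 2 Phi + r 0 - g / 2. For
   b = a or b = - a the factor phi + b Phi solves a first order equation, and
   F b is the primitive of expR (- b u) g u that this yields. *)
Let F (b t : R) : R :=
  2 * (r 0 * (1 - expR (- b * t)) / b - expR (- b * t) * (phi t + b * Phi t)).

Let F0 b : F b 0 = 0.
Proof. by rewrite /F mulr0 expR0 subrr Phi00 phi00; ring. Qed.

Let dF (b t : R) : b ^+ 2 = a ^+ 2 -> 0 < t ->
  is_derive t 1 (F b) (expR (- b * t) * g t).
Proof.
move=> ba t0; have b0 : b != 0 by rewrite -sqrf_eq0 ba sqrf_eq0 gt_eqF.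
have dP := dPhi t0; have dp := dphi t0.
have de : is_derive t 1 (fun x : R => expR (- b * x)) (- b * expR (- b * t)).
  by apply: is_derive_eq; rewrite /GRing.scale/= mulr1 mulrC.
have := is_deriveZ 2 (is_deriveB
  (is_deriveZ (r 0 / b) (is_deriveB (is_derive_cst (1 : R) t 1) de))
  (is_deriveM de (is_deriveD dp (is_deriveZ b dP)))).
set f := (X in is_derive _ _ X _) => h.
have -> : F b = f.
  apply/funext => x; change (F b x = 2 * (r 0 / b * (1 - expR (- b * x))
    - expR (- b * x) * (phi x + b * Phi x))).
  by rewrite /F; field.
apply: (is_derive_eq h).
change (2 * (r 0 / b * (0 - (- b * expR (- b * t)))
  - (expR (- b * t) * (r t + b * phi t)
     + (phi t + b * Phi t) * (- b * expR (- b * t)))) = expR (- b * t) * g t).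
rewrite (rE (ltW t0)) -ba.
by field.
Qed.

Let F_right0 b : F b t @[t --> 0^'+] --> F b 0.
Proof.
have ce : expR (- b * t) @[t --> 0^'+] --> (1 : R).
  have := cvg_at_right_filter (@continuous_expRM (- b) 0).
  by rewrite mulr0 expR0.
rewrite F0 [X in _ --> X](_ : 0 = 2 * (r 0 * (1 - 1) / b - 1 * (0 + b * 0))); last by ring.
apply: cvgM; first exact: cvg_cst.
apply: cvgB.
  apply: cvgM; last exact: cvg_cst.
  by apply: cvgM; [exact: cvg_cst | apply: cvgB => //; exact: cvg_cst].
apply: cvgM => //; apply: cvgD => //.
by apply: cvgM => //; exact: cvg_cst.
Qed.

Let cexpg b : {within `[0, +oo[, continuous (fun u => expR (- b * u) * g u)}.
Proof.
move=> x; apply: cvgM; last exact: gc.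
by move: x; apply: continuous_subspaceT; exact: continuous_expRM.
Qed.

Let int_expg b t : b ^+ 2 = a ^+ 2 -> 0 < t ->
  \int[mu]_(u in `[0, t]) (expR (- b * u) * g u) = F b t.
Proof.
move=> ba t0; rewrite /Rintegral (@continuous_FTC2 _ _ (F b))//=.
- by rewrite F0 oppr0 addr0.
- apply: (continuous_subspaceW (A := `[0, t]) (B := `[0, +oo[)); last exact: cexpg.
  move=> u /=.
  by rewrite !in_itv/= => /andP[->].
- split => [u||].
  + by rewrite in_itv/= => /andP[u0 _]; have [] := dF ba u0.
  + exact: F_right0.
  + apply: cvg_at_left_filter.
    apply: differentiable_continuous; apply/derivable1_diffP.
    by have [] := dF ba t0.
- move=> u; rewrite in_itv/= => /andP[u0 _]; rewrite derive1E.
  by have [_] := dF ba u0.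
Qed.

Let cvg_expR0 (b : R) : 0 < b -> expR (- b * t) @[t --> +oo] --> 0.
Proof.
move=> b0.
rewrite (_ : (fun x => _) = (fun z => expR (- z)) \o (fun z => b * z)); last first.
  by apply/funext => x /=; rewrite mulNr.
apply: (@cvg_comp _ _ _ _ _ _ (pinfty_nbhs R)); last exact: cvgr_expR.
exact: gt0_cvgMry.
Qed.

(** A solution of polynomial growth has no component along [expR (a * t)], which
    forces [F a] to have the limit [2 * r 0 / a] at infinity. This determines
    [r 0]. *)
Lemma bounded_solution0 :
  r 0 = a / 2 * \int[mu]_(u in `[0, +oo[) (expR (- a * u) * g u).
Proof.
rewrite (@Rintegral_ge0_continuous_FTC2y _ _ (F a) 0 (2 * r 0 / a)).
- by rewrite F0; field; rewrite gt_eqF.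
- by move=> x x0; rewrite mulr_ge0 ?expR_ge0 ?g0.
- exact: cexpg.
- rewrite (_ : 2 * r 0 / a = 2 * (r 0 * (1 - 0) / a - 0)); last by ring.
  apply: cvgM; first exact: cvg_cst.
  apply: cvgB.
    apply: cvgM; last exact: cvg_cst.
    apply: cvgM; first exact: cvg_cst.
    by apply: cvgB; [exact: cvg_cst | exact: cvg_expR0].
  have a20 : 0 < a / 2 by rewrite divr_gt0.
  apply/norm_cvg0P.
  have hcvg : K * (1 + 48 / a ^+ 3) * expR (- (a / 2) * t) @[t --> +oo] --> 0.
    rewrite -[X in _ --> X](mulr0 (K * (1 + 48 / a ^+ 3))).
    by apply: cvgM; [exact: cvg_cst | exact: cvg_expR0].
  apply: (squeeze_cvgr _ (cvg_cst 0) hcvg).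
  near=> t; have t0 : 0 <= t by near: t; exact: nbhs_pinfty_ge.
  rewrite normr_ge0/= normrM ger0_norm ?expR_ge0// mulrC.
  apply: (@le_trans _ _ (K * (1 + t ^+ 3) * expR (- a * t))).
    by rewrite ler_wpM2r ?expR_ge0 ?PhiK.
  have K0 : 0 <= K.
    have := le_trans (normr_ge0 _) (PhiK (lexx 0)).
    by rewrite expr0n/= addr0 mulr1.
  by rewrite -!mulrA ler_wpM2l// cube_le_expR.
- by move=> x x0; have [] := dF (erefl (a ^+ 2)) x0.
- exact: F_right0.
- move=> u; rewrite in_itv/= => /andP[u0 _]; rewrite derive1E.
  by have [_] := dF (erefl (a ^+ 2)) u0.
Unshelve. all: by end_near. Qed.

(** [Phi] is recovered as the difference of [phi + a Phi] and [phi - a Phi]. *)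
Lemma bounded_solutionE t : 0 <= t -> r t = langevin_cov a g t.
Proof.
rewrite /langevin_cov le_eqVlt => /predU1P[<-|t0].
  rewrite !set_itv1 !Rintegral_set1 !mulr0 expR0 subrr mulr0 subr0.
  have g00 : g 0 = 0.
    by have := rE (lexx 0); rewrite Phi00; lra.
  by rewrite g00 mul0r subr0 [LHS]bounded_solution0; field.
have := int_expg (erefl (a ^+ 2)) t0; have := int_expg (sqrrN a) t0.
rewrite opprK => -> ->.
rewrite -mulrA [X in _ * X]mulrC.
have eN : expR (a * t) * expR (- a * t) = 1.
  by rewrite mulNr expRN mulfV// gt_eqF// expR_gt0.
rewrite (rE (ltW t0)) /F !opprK bounded_solution0.
move: (expR (a * t)) (expR (- a * t)) eN => e1 e2 eN.
set I := \int[mu]_(u in _) _.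
have -> : e1 * (2 * (a / 2 * I * (1 - e2) / a - e2 * (phi t + a * Phi t)))
  = I * (e1 - e1 * e2) - 2 * (e1 * e2) * (phi t + a * Phi t).
  by field; rewrite gt_eqF.
have -> : e2 * (2 * (a / 2 * I * (1 - e1) / - a - e1 * (phi t + - a * Phi t)))
  = I * (e1 * e2 - e2) - 2 * (e1 * e2) * (phi t - a * Phi t).
  by field; rewrite gt_eqF.
by rewrite eN; field.
Qed.

End bounded_solution.

Section langevin_covariance.
Context {R : realType}.
Local Notation mu := (@lebesgue_measure R).
Implicit Types (a t h : R).

Lemma within_continuous_powR (p : R) : 0 < p ->
  {within `[0, +oo[, continuous (fun u : R => u `^ p)}.
Proof.
move=> p0; apply/continuous_within_itvcyP; split.
  move=> u u0; apply: differentiable_continuous; apply/derivable1_diffP.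
  exact: derivable_powR.
by rewrite powR0 ?gt_eqF//; exact: powR_cvg0.
Qed.

Section kernels.
Variables (a t : R).
Hypotheses (a0 : 0 < a) (t0 : 0 <= t).

(* The three weights of langevin_cov all decay like expR (- a u) on their
   domains, so they can be treated at once. *)
Let kernelP (P : set R -> (R -> R) -> Prop) :
  (forall (D : set R) (w : R -> R) (C : R),
    measurable D -> D `<=` `[0, +oo[ -> measurable_fun D w ->
    (forall u, D u -> `|w u| <= C * expR (- a * u)) -> P D w) ->
  [/\ P `[0, +oo[%classic (fun u => expR (- a * u)),
      P `[0, t]%classic (fun u => expR (- a * u)) &
      P `[0, t]%classic (fun u => expR (a * u))].
Proof.
move=> H.
have me b D : measurable D -> measurable_fun D (fun u : R => expR (b * u)).
  move=> mD; apply: measurable_funTS; apply: continuous_measurable_fun.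
  exact: continuous_expRM.
have t0y : `[0, t] `<=` `[0, +oo[%classic.
  by move=> u /=; rewrite !in_itv/= => /andP[->].
split.
- by apply: (H _ _ 1) => // [|u _]; [exact: me | rewrite mul1r ger0_norm ?expR_ge0].
- by apply: (H _ _ 1) => // [|u _]; [exact: me | rewrite mul1r ger0_norm ?expR_ge0].
- apply: (H _ _ (expR (2 * a * t))) => // [|u]; first exact: me.
  rewrite /= in_itv/= => /andP[_ ut].
  rewrite ger0_norm ?expR_ge0// -expRD ler_expR.
  suff : a * u <= a * t by lra.
  by rewrite ler_pM2l.
Qed.

Lemma integrable_langevin h : 1 / 2 <= h <= 1 ->
  [/\ mu.-integrable `[0, +oo[ (EFin \o (fun u => expR (- a * u) * u `^ (2 * h))),
      mu.-integrable `[0, t] (EFin \o (fun u => expR (- a * u) * u `^ (2 * h))) &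
      mu.-integrable `[0, t] (EFin \o (fun u => expR (a * u) * u `^ (2 * h)))].
Proof.
move=> h12; apply: (kernelP (P := fun D w => mu.-integrable D
  (EFin \o (fun u => w u * u `^ (2 * h))))) => D w C mD D0 mw wC.
exact: (integrable_kernel_powR mD D0 mw a0 wC).
Qed.

Lemma derivable_langevin_powR h : 1 / 2 < h < 1 ->
  derivable (fun x : R => langevin_cov a (fun u => u `^ (2 * x)) t) h 1.
Proof.
move=> h12.
have [dy dN dP] : [/\ derivable (fun x : R =>
      \int[mu]_(u in `[0, +oo[) (expR (- a * u) * u `^ (2 * x)) : R) h 1,
    derivable (fun x : R =>
      \int[mu]_(u in `[0, t]) (expR (- a * u) * u `^ (2 * x)) : R) h 1 &
    derivable (fun x : R =>
      \int[mu]_(u in `[0, t]) (expR (a * u) * u `^ (2 * x)) : R) h 1].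
  apply: (kernelP (P := fun D w => derivable (fun x : R =>
    \int[mu]_(u in D) (w u * u `^ (2 * x)) : R) h 1)) => D w C mD D0 mw wC.
  exact: (derivable_kernel_powR mD D0 mw a0 wC).
have h0 : 0 < h by lra.
have [dp _] := is_derive_powR_exponent t0 h0.
apply: derivableB; first apply: derivableB.
- by apply: derivableM; [exact: derivable_cst | exact: dy].
- by apply: derivableM; [exact: dp | exact: derivable_cst].
- apply: derivableM; first exact: derivable_cst.
  apply: derivableB.
    by apply: derivableM; [exact: derivable_cst | exact: dN].
  by apply: derivableM; [exact: derivable_cst | exact: dP].
Qed.

Lemma langevin_covD (c h : R) : 1 / 2 <= h <= 1 ->
  langevin_cov a (fun u => c * u `^ (2 * h) + u) t
  = c * langevin_cov a (fun u => u `^ (2 * h)) t + langevin_cov a id t.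
Proof.
move=> h12; have [iy iN iP] := integrable_langevin h12.
have half : 1 / 2 <= (1 / 2 : R) <= 1 by rewrite lexx/=; lra.
have [jy jN jP] := integrable_langevin half.
have intE (D : set R) (w : R -> R) : measurable D -> D `<=` `[0, +oo[ ->
    mu.-integrable D (EFin \o (fun u => w u * u `^ (2 * h))) ->
    mu.-integrable D (EFin \o (fun u => w u * u `^ (2 * (1 / 2)))) ->
    \int[mu]_(u in D) (w u * (c * u `^ (2 * h) + u))
    = c * \int[mu]_(u in D) (w u * u `^ (2 * h)) + \int[mu]_(u in D) (w u * u).
  move=> mD D0 i1 i2.
  have u1 : {in D, (fun u => w u * u `^ (2 * (1 / 2))) =1 (fun u => w u * u)}.
    move=> u; rewrite inE => /D0; rewrite /= in_itv/= andbT => u0.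
    by rewrite (_ : 2 * (1 / 2) = 1) ?powRr1 //; field.
  have {}i2 : mu.-integrable D (EFin \o (fun u => w u * u)).
    by apply: eq_integrable i2 => // u Du; rewrite /= (u1 u).
  rewrite -RintegralZl// -RintegralD//.
    by apply: eq_Rintegral => u _; rewrite mulrDr mulrCA.
  have := @integrableZl _ _ _ mu D _ c _ i1; exact.
have t0y : `[0, t] `<=` `[0, +oo[%classic.
  by move=> u /=; rewrite !in_itv/= => /andP[->].
have m0y := measurable_itv (`[0, +oo[ : interval R).
have m0t := measurable_itv (`[0, t] : interval R).
have ey := intE _ (fun u => expR (- a * u)) m0y (@subset_refl _ _) iy jy.
have eN := intE _ (fun u => expR (- a * u)) m0t t0y iN jN.
have eP := intE _ (fun u => expR (a * u)) m0t t0y iP jP.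
rewrite /langevin_cov ey eN eP.
set Iy := \int[mu]_(u in `[0, +oo[) (expR (- a * u) * u `^ (2 * h)).
set IN := \int[mu]_(u in `[0, t]) (expR (- a * u) * u `^ (2 * h)).
set IP := \int[mu]_(u in `[0, t]) (expR (a * u) * u `^ (2 * h)).
set Jy := \int[mu]_(u in `[0, +oo[) (expR (- a * u) * u).
set JN := \int[mu]_(u in `[0, t]) (expR (- a * u) * u).
set JP := \int[mu]_(u in `[0, t]) (expR (a * u) * u).
clearbody Iy IN IP Jy JN JP; ring.
Qed.

(** For a Brownian driver the right hand side is the covariance of the classical
    Ornstein-Uhlenbeck process, which solves the same integral equation. *)
Lemma langevin_cov_id : langevin_cov a id t = expR (- a * t) / (2 * a).
Proof.
pose r (u : R) := expR (- a * u) / (2 * a).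
pose phi (u : R) := (1 - expR (- a * u)) / (2 * a ^+ 2).
pose Phi (u : R) := u / (2 * a ^+ 2) - phi u / a.
have an0 : a != 0 by rewrite gt_eqF.
have de (u : R) : is_derive u 1 (fun x : R => expR (- a * x)) (- a * expR (- a * u)).
  by apply: is_derive_eq; rewrite /GRing.scale/= mulr1 mulrC.
have dphi (u : R) : is_derive u 1 phi (r u).
  have := is_deriveZ ((2 * a ^+ 2)^-1) (is_deriveB (is_derive_cst (1 : R) u 1) (de u)).
  set f := (X in is_derive _ _ X _) => hf.
  have -> : phi = f.
    by apply/funext => x; rewrite /phi mulrC.
  apply: (is_derive_eq hf).
  change ((2 * a ^+ 2)^-1 * (0 - (- a * expR (- a * u))) = r u).
  by rewrite /r; field.
have dPhi (u : R) : is_derive u 1 Phi (phi u).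
  have := is_deriveB (is_deriveZ ((2 * a ^+ 2)^-1) (is_derive_id u (1 : R)))
    (is_deriveZ a^-1 (dphi u)).
  set f := (X in is_derive _ _ X _) => hf.
  have -> : Phi = f.
    apply/funext => x.
    change (Phi x = (2 * a ^+ 2)^-1 * x - a^-1 * phi x).
    by rewrite /Phi mulrC; congr (_ - _); rewrite mulrC.
  apply: (is_derive_eq hf).
  change ((2 * a ^+ 2)^-1 * 1 - a^-1 * r u = phi u).
  by rewrite /phi /r; field.
have phi00 : phi 0 = 0 by rewrite /phi mulr0 expR0 subrr mul0r.
have Phi00 : Phi 0 = 0 by rewrite /Phi phi00 !mul0r subrr.
have cphi : phi u @[u --> 0^'+] --> 0.
  rewrite -[X in _ --> X]phi00; apply: cvg_at_right_filter.
  by apply: differentiable_continuous; apply/derivable1_diffP; have [] := dphi 0.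
have cPhi : Phi u @[u --> 0^'+] --> 0.
  rewrite -[X in _ --> X]Phi00; apply: cvg_at_right_filter.
  by apply: differentiable_continuous; apply/derivable1_diffP; have [] := dPhi 0.
rewrite -/(r t); apply/esym.
apply: (@bounded_solutionE _ a id r phi Phi (1 / (2 * a))) => //.
- by apply: continuous_subspaceT => x; exact: cvg_id.
- move=> u u0; rewrite /Phi.
  have -> : phi u + a * (u / (2 * a ^+ 2) - phi u / a) = u / (2 * a) by field.
  rewrite ger0_norm; last by rewrite divr_ge0// mulr_ge0// ltW.
  rewrite mulrC mul1r ler_pM2l ?invr_gt0 ?mulr_gt0//.
  have [u1|/ltW u1] := leP u 1; first by rewrite (le_trans u1)// lerDl exprn_ge0.
  by rewrite (@le_trans _ _ (u ^+ 3))// ?lerDr// ler_eXnr.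
- by move=> u u0; rewrite /r /Phi /phi mulr0 expR0 /=; field.
Qed.

End kernels.

End langevin_covariance.

(** * Square integrable random variables *)

Section square_integrable.
Context d (T : measurableType d) (R : realType) (P : probability T R).
Implicit Types X Y Z : T -> R.

Lemma Lfun2I X : measurable_fun setT X ->
  (\int[P]_w (X w ^+ 2)%:E < +oo)%E -> X \in Lfun P 2%:E.
Proof.
move=> mX X2; rewrite inE; apply/andP; split; rewrite inE//=.
rewrite /finite_norm unlock poweR_lty//.
rewrite (eq_integral (fun w => (X w ^+ 2)%:E))// => w _.
rewrite -[LHS]/((`|X w| `^ 2)%:E).
by rewrite powR_mulrn// -normrX ger0_norm ?sqr_ge0.
Qed.

Lemma measurable_Lfun2 X : X \in Lfun P 2%:E -> measurable_fun setT X.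
Proof. by rewrite inE => /andP[]; rewrite inE. Qed.

Lemma Lfun2_Lfun1 X : X \in Lfun P 2%:E -> X \in Lfun P 1.
Proof. by apply: Lfun_subset12; exact: fin_num_measure. Qed.

Lemma Lfun2_integrable_mul X Y : X \in Lfun P 2%:E -> Y \in Lfun P 2%:E ->
  P.-integrable setT (EFin \o (fun w => X w * Y w)).
Proof. by move=> X2 Y2; apply/Lfun1_integrable; exact: Lfun2_mul_Lfun1. Qed.

Lemma Lfun2_integrable X : X \in Lfun P 2%:E -> P.-integrable setT (EFin \o X).
Proof. by move=> /Lfun2_Lfun1/Lfun1_integrable. Qed.

Lemma Lfun2D X Y : X \in Lfun P 2%:E -> Y \in Lfun P 2%:E ->
  (fun w => X w + Y w) \in Lfun P 2%:E.
Proof. by move=> X2 Y2; apply: rpredD => //; rewrite lee1n. Qed.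

Lemma Lfun2Z (c : R) X : X \in Lfun P 2%:E -> (fun w => c * X w) \in Lfun P 2%:E.
Proof.
move=> X2; rewrite (_ : (fun w => _) = c \o* X).
  by apply: Lfun_scale => //; rewrite ler1n.
by apply/funext => w /=; rewrite mulrC.
Qed.

Lemma Lfun2_sum (I : Type) (r : seq I) (c : I -> R) (U : I -> T -> R) :
  (forall i, U i \in Lfun P 2%:E) ->
  (fun w => \sum_(i <- r) c i * U i w) \in Lfun P 2%:E.
Proof.
move=> U2; elim: r => [|i r IH].
  by under eq_fun do rewrite big_nil; exact: Lfun_cst.
under eq_fun do rewrite big_cons.
by apply: Lfun2D => //; exact: Lfun2Z.
Qed.

Definition cov X Y : R := fine (covariance P X Y).

Lemma covC X Y : cov X Y = cov Y X.
Proof. by rewrite /cov covarianceC. Qed.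

Lemma covE X Y : X \in Lfun P 2%:E -> Y \in Lfun P 2%:E ->
  cov X Y = \int[P]_w (X w * Y w) - (\int[P]_w X w) * \int[P]_w Y w.
Proof.
move=> X2 Y2; have X1 := Lfun2_Lfun1 X2; have Y1 := Lfun2_Lfun1 Y2.
have XY1 := Lfun2_mul_Lfun1 X2 Y2.
rewrite /cov covarianceE// fineB ?fin_numM ?expectation_fin_num//.
by rewrite fineM ?expectation_fin_num// unlock.
Qed.

Lemma covDl X Y Z : X \in Lfun P 2%:E -> Y \in Lfun P 2%:E ->
  Z \in Lfun P 2%:E -> cov (fun w => X w + Y w) Z = cov X Z + cov Y Z.
Proof.
move=> X2 Y2 Z2; rewrite /cov (covarianceDl X2 Y2 Z2) fineD//.
  by apply: covariance_fin_num;
    [exact: Lfun2_Lfun1 | exact: Lfun2_Lfun1 | exact: Lfun2_mul_Lfun1].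
by apply: covariance_fin_num;
  [exact: Lfun2_Lfun1 | exact: Lfun2_Lfun1 | exact: Lfun2_mul_Lfun1].
Qed.

Lemma covZl (c : R) X Y : X \in Lfun P 2%:E -> Y \in Lfun P 2%:E ->
  cov (fun w => c * X w) Y = c * cov X Y.
Proof.
move=> X2 Y2; have X1 := Lfun2_Lfun1 X2; have Y1 := Lfun2_Lfun1 Y2.
have XY1 := Lfun2_mul_Lfun1 X2 Y2.
have := covarianceZl c X1 Y1 XY1; rewrite /cov (_ : c \o* X = fun w => c * X w).
  by move=> ->; rewrite fineM// covariance_fin_num.
by apply/funext => w /=; rewrite mulrC.
Qed.

Lemma covBl X Y Z : X \in Lfun P 2%:E -> Y \in Lfun P 2%:E ->
  Z \in Lfun P 2%:E -> cov (fun w => X w - Y w) Z = cov X Z - cov Y Z.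
Proof.
move=> X2 Y2 Z2; under [X in cov X]eq_fun do rewrite -[- Y _]mulN1r.
by rewrite covDl ?Lfun2Z// covZl// mulN1r.
Qed.

Lemma Lfun2B X Y : X \in Lfun P 2%:E -> Y \in Lfun P 2%:E ->
  (fun w => X w - Y w) \in Lfun P 2%:E.
Proof. by move=> X2 Y2; apply: rpredB => //; rewrite lee1n. Qed.

Lemma covBB X X' Y Y' : X \in Lfun P 2%:E -> X' \in Lfun P 2%:E ->
  Y \in Lfun P 2%:E -> Y' \in Lfun P 2%:E ->
  cov (fun w => X w - X' w) (fun w => Y w - Y' w)
  = cov X Y - cov X Y' - (cov X' Y - cov X' Y').
Proof.
move=> X2 X'2 Y2 Y'2; have YY'2 := Lfun2B Y2 Y'2.
rewrite (covBl X2 X'2 YY'2) !(covC _ (fun w => Y w - Y' w)).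
by rewrite (covBl Y2 Y'2 X2) (covBl Y2 Y'2 X'2) !(covC Y) !(covC Y').
Qed.

Lemma cov_sum (I : Type) (r : seq I) (c : I -> R) (U : I -> T -> R) Z :
  (forall i, U i \in Lfun P 2%:E) -> Z \in Lfun P 2%:E ->
  cov (fun w => \sum_(i <- r) c i * U i w) Z = \sum_(i <- r) c i * cov (U i) Z.
Proof.
move=> U2 Z2; elim: r => [|i r IH].
  rewrite big_nil; under eq_fun do rewrite big_nil.
  by rewrite /cov covariance_cst_l.
rewrite big_cons -IH; under eq_fun do rewrite big_cons.
by rewrite covDl ?Lfun2Z ?Lfun2_sum// covZl.
Qed.

Lemma cov_ge0 X : 0 <= cov X X.
Proof. exact/fine_ge0/variance_ge0. Qed.

Lemma cov_psd n (U : 'I_n -> T -> R) (x : 'cV[R]_n) :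
  (forall i, U i \in Lfun P 2%:E) ->
  0 <= (x^T *m (\matrix_(i, j) cov (U i) (U j)) *m x) 0 0.
Proof.
move=> U2; have := cov_ge0 (fun w => \sum_i x i 0 * U i w).
rewrite cov_sum ?Lfun2_sum//; congr (0 <= _).
rewrite mxE; apply: eq_bigr => i _; rewrite covC cov_sum// mulrC; congr (_ * _).
by rewrite mxE; apply: eq_bigr => j _; rewrite !mxE.
Qed.

(** Cauchy-Schwarz, in the form of Young's inequality. *)
Lemma cov_young (l : R) X Y : 0 < l -> X \in Lfun P 2%:E -> Y \in Lfun P 2%:E ->
  `|cov X Y| <= (l * cov X X + l^-1 * cov Y Y) / 2.
Proof.
move=> l0 X2 Y2.
have H (e : R) : e ^+ 2 = 1 -> 0 <= l * cov X X + l^-1 * cov Y Y + 2 * e * cov X Y.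
  move=> e1; have := cov_ge0 (fun w => l * X w + e * Y w).
  rewrite covDl ?covZl ?Lfun2D ?Lfun2Z// !(covC _ (fun w => _ + _)).
  rewrite !covDl ?covZl ?Lfun2Z// (covC Y X) => h.
  have : 0 <= l^-1 * (l * (l * cov X X + e * cov X Y) + e * (l * cov X Y + e * cov Y Y)).
    by rewrite mulr_ge0// invr_ge0 ltW.
  rewrite (_ : l^-1 * _ = l * cov X X + e ^+ 2 * (l^-1 * cov Y Y) + 2 * e * cov X Y).
    by rewrite e1 mul1r.
  by field; rewrite gt_eqF.
have := H 1 (expr1n _ _); have := H (-1) _; rewrite sqrrN expr1n => /(_ erefl) h1 h2.
by rewrite ler_norml; apply/andP; split; lra.
Qed.

Lemma cov_sub_le X Y : X \in Lfun P 2%:E -> Y \in Lfun P 2%:E ->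
  cov (fun w => X w - Y w) (fun w => X w - Y w) <= 2 * (cov X X + cov Y Y).
Proof.
move=> X2 Y2; rewrite (covBB X2 Y2 X2 Y2) (covC Y X).
have := cov_young ltr01 X2 Y2; rewrite invr1 ler_norml => /andP[h _]; lra.
Qed.

End square_integrable.

Section gaussian_moments.
Context {R : realType}.
Local Notation mu := (@lebesgue_measure R).

(** Since [y * expR (- y) <= 1], the function [x ^+ 2] times the centered Gaussian
    density with variance [s ^+ 2] is at most a multiple of the density with
    variance [2 * s ^+ 2]. *)
Lemma normal_second_moment (s : R) : 0 < s ->
  (\int[normal_prob 0 s]_x (x ^+ 2)%:E < +oo)%E.
Proof.
move=> s0.
have dom := normal_prob_dominates 0 s.
(* The Radon-Nikodym derivative is almost everywhere the Gaussian density. *)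
rewrite -(Radon_Nikodym_SigmaFinite.change_of_variables dom); first last.
- by apply/measurable_EFinP; exact: measurable_funX.
- exact: measurableT.
- by move=> x; rewrite lee_fin sqr_ge0.
rewrite (@ae_eq_integral _ _ _ mu setT
  (fun x => (x ^+ 2)%:E * (normal_pdf 0 s x)%:E)%E)//; first last.
- apply: ae_eqe_mul2l; apply: integral_ae_eq => //.
  + exact: Radon_Nikodym_SigmaFinite.f_integrable.
  + by apply/measurable_EFinP; exact: measurable_normal_pdf.
  + by move=> E _ mE; rewrite -Radon_Nikodym_SigmaFinite.f_integral.
- apply: emeasurable_funM; apply/measurable_EFinP; first exact: measurable_funX.
  exact: measurable_normal_pdf.
- apply: emeasurable_funM; first by apply/measurable_EFinP; exact: measurable_funX.
  exact: measurable_int (Radon_Nikodym_SigmaFinite.f_integrable dom).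
pose s' := Num.sqrt 2 * s.
have s'0 : 0 < s' by rewrite mulr_gt0// sqrtr_gt0.
have s'2 : s' ^+ 2 = 2 * s ^+ 2 by rewrite exprMn sqr_sqrtr.
pose C := 4 * s ^+ 2 * (normal_peak s / normal_peak s').
have p0 := normal_peak_gt0 (lt0r_neq0 s0).
have p'0 := normal_peak_gt0 (lt0r_neq0 s'0).
apply: (@le_lt_trans _ _ (\int[mu]_x (C%:E * (normal_pdf 0 s' x)%:E))%E).
  apply: ge0_le_integral => //.
  - by move=> x _; rewrite -EFinM lee_fin mulr_ge0 ?sqr_ge0 ?normal_pdf_ge0.
  - apply: emeasurable_funM; apply/measurable_EFinP; first exact: measurable_funX.
    exact: measurable_normal_pdf.
  - by apply: measurable_funeM; apply/measurable_EFinP; exact: measurable_normal_pdf.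
  move=> x _; rewrite -!EFinM lee_fin /normal_pdf !gt_eqF//.
  rewrite /normal_fun !subr0 s'2 /C.
  set y := x ^+ 2 / (4 * s ^+ 2).
  have sn0 := lt0r_neq0 s0.
  have -> : - x ^+ 2 / (s ^+ 2 *+ 2) = - y - y by rewrite /y -mulr_natr; field.
  have -> : - x ^+ 2 / (2 * s ^+ 2 *+ 2) = - y by rewrite /y -mulr_natr; field.
  rewrite expRD.
  have -> : x ^+ 2 = 4 * s ^+ 2 * y by rewrite /y; field.
  have y0 : 0 <= y by rewrite divr_ge0 ?sqr_ge0// mulr_ge0 ?sqr_ge0.
  have ye : y * expR (- y) <= 1.
    rewrite expRN ler_pdivrMr ?expR_gt0// mul1r.
    by rewrite (le_trans _ (expR_ge1Dx y))// lerDr.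
  rewrite [leLHS](_ : _ = 4 * s ^+ 2 * normal_peak s * expR (- y)
    * (y * expR (- y))); last by ring.
  rewrite [leRHS](_ : _ = 4 * s ^+ 2 * normal_peak s * expR (- y) * 1); last first.
    by field; rewrite gt_eqF.
  rewrite ler_wpM2l// mulr_ge0 ?expR_ge0// mulr_ge0 ?(ltW p0)//.
  by rewrite mulr_ge0 ?sqr_ge0.
rewrite integralZl//; last exact: integrable_normal_pdf.
by rewrite integral_normal_pdf mule1 ltry.
Qed.

Lemma centered_gaussian_Lfun2 d (T : measurableType d) (P : probability T R)
    (Z : T -> R) : measurable_fun setT Z -> centered_gaussian P Z ->
  Z \in Lfun P 2%:E.
Proof.
move=> mZ gZ; apply: Lfun2I => //.
have mZ' : @measurable_fun _ _ T (measurableTypeR R) setT Z by [].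
pose Zm : {mfun T >-> measurableTypeR R} :=
  HB.pack Z (isMeasurableFun.Build _ _ T (measurableTypeR R) Z mZ').
have msq : measurable_fun setT (fun x : measurableTypeR R => (x ^+ 2)%:E).
  by apply/measurable_EFinP; exact: measurable_funX.
have -> : (\int[P]_w (Z w ^+ 2)%:E
    = \int[distribution P Zm]_x (x ^+ 2)%:E)%E.
  by rewrite ge0_integral_distribution// => x; rewrite lee_fin sqr_ge0.
case: gZ => [[s s0 Zs]|Z0].
  rewrite (eq_measure_integral (normal_prob 0 s)); last first.
    by move=> A mA _; exact: Zs.
  exact: normal_second_moment.
rewrite (eq_measure_integral (dirac ((0 : R) : measurableTypeR R))); last first.
  by move=> A mA _; exact: Z0.
by rewrite integral_dirac//= diracT mul1e ltry.
Qed.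

Lemma centered_gaussian_process_Lfun2 d (T : measurableType d)
    (P : probability T R) (X : R -> {mfun T >-> R}) (t : R) : 0 <= t ->
  centered_gaussian_process P X -> (X t : T -> R) \in Lfun P 2%:E.
Proof.
move=> t0 gX; apply: centered_gaussian_Lfun2; first exact: measurable_funP.
have := gX 1%N (fun=> t) (fun=> 1) (fun=> t0).
by under eq_fun do rewrite big_ord1 mul1r.
Qed.

End gaussian_moments.

(** * Laws of pairs *)

Section joint_laws.
Context {R : realType}.
Local Notation R2 := (measurableTypeR R * measurableTypeR R)%type.

Let measurable_rectangles :
  (measurable : set (set R2))
  = <<s [set C | exists A B : set (measurableTypeR R),
           [/\ measurable A, measurable B & C = A `*` B]] >>.
Proof.
rewrite measurable_prod_measurableType; congr (<<s _ >>).
apply/seteqP; split => [C [A mA [B mB <-]]|C [A [B [mA mB ->]]]].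
  by exists A, B.
by exists A => //; exists B.
Qed.

(** Rectangles are stable under intersection and generate the product
    sigma-algebra, so they determine the law of a pair. *)
Lemma eq_rectangles (m1 m2 : probability R2 R) :
  (forall A B : set (measurableTypeR R), measurable A -> measurable B ->
    m1 (A `*` B) = m2 (A `*` B)) ->
  forall C : set R2, measurable C -> m1 C = m2 C.
Proof.
move=> m12 C mC; apply: (measure_unique _ (fun=> setT) measurable_rectangles) => //.
- move=> _ _ [A [B [mA mB ->]]] [A' [B' [mA' mB' ->]]].
  rewrite -setXI; exists (A `&` A'), (B `&` B').
  by split => //; exact: measurableI.
- by move=> _; exists setT, setT; rewrite setXTT.
- by rewrite bigcup_const//; exists 0%N.
- by move=> _ [A [B [mA mB ->]]]; exact: m12.
- by move=> _; rewrite (le_lt_trans (probability_le1 _ _))// ltry.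
Qed.

Definition joint d (T : measurableType d) (f g : T -> R) (w : T) : R2 := (f w, g w).

Lemma measurable_joint d (T : measurableType d) (f g : T -> R) :
  measurable_fun setT f -> measurable_fun setT g -> measurable_fun setT (joint f g).
Proof. by move=> mf mg; apply: measurable_fun_pair. Qed.

Lemma measurable_mul2 : measurable_fun setT (fun z : R2 => (z.1 * z.2)%:E).
Proof. by apply/measurable_EFinP; apply: measurable_funM. Qed.

Section law.
Context d (T : measurableType d) (P : probability T R) (f g : T -> R).
Hypotheses (mf : measurable_fun setT f) (mg : measurable_fun setT g).

Definition joint_mfun : {mfun T >-> R2} :=
  HB.pack (joint f g)
    (isMeasurableFun.Build _ _ T R2 (joint f g) (measurable_joint mf mg)).

Lemma integral_joint : P.-integrable setT (EFin \o (fun w => f w * g w)) ->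
  (\int[P]_w (f w * g w)%:E
   = \int[distribution P joint_mfun]_z (z.1 * z.2)%:E)%E.
Proof. by move=> ifg; rewrite integral_distribution//; exact: measurable_mul2. Qed.

End law.

Lemma eq_integral_mul d (T : measurableType d) (P : probability T R)
    d' (T' : measurableType d') (P' : probability T' R)
    (f g : T -> R) (f' g' : T' -> R) :
  f \in Lfun P 2%:E -> g \in Lfun P 2%:E ->
  f' \in Lfun P' 2%:E -> g' \in Lfun P' 2%:E ->
  (forall A B : set R, measurable A -> measurable B ->
    P (f @^-1` A `&` g @^-1` B) = P' (f' @^-1` A `&` g' @^-1` B)) ->
  \int[P]_w (f w * g w) = \int[P']_w (f' w * g' w).
Proof.
move=> f2 g2 f'2 g'2 PP'; rewrite /Rintegral; congr fine.
have mf := measurable_Lfun2 f2; have mg := measurable_Lfun2 g2.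
have mf' := measurable_Lfun2 f'2; have mg' := measurable_Lfun2 g'2.
rewrite (integral_joint mf mg (Lfun2_integrable_mul f2 g2)).
rewrite (integral_joint mf' mg' (Lfun2_integrable_mul f'2 g'2)).
apply: eq_measure_integral => C mC _.
apply: (eq_rectangles (m1 := distribution P (joint_mfun mf mg))
  (m2 := distribution P' (joint_mfun mf' mg'))) => // A B mA mB.
Qed.

Lemma Lfun2_cst d (T : measurableType d) (P : probability T R) (c : R) :
  (fun=> c : R) \in Lfun P 2%:E.
Proof. exact: Lfun_cst. Qed.

Lemma eq_cov_law d (T : measurableType d) (P : probability T R)
    d' (T' : measurableType d') (P' : probability T' R)
    (f g : T -> R) (f' g' : T' -> R) :
  f \in Lfun P 2%:E -> g \in Lfun P 2%:E ->
  f' \in Lfun P' 2%:E -> g' \in Lfun P' 2%:E ->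
  (forall A B : set R, measurable A -> measurable B ->
    P (f @^-1` A `&` g @^-1` B) = P' (f' @^-1` A `&` g' @^-1` B)) ->
  cov P f g = cov P' f' g'.
Proof.
move=> f2 g2 f'2 g'2 PP'; rewrite !covE// (eq_integral_mul f2 g2 f'2 g'2)//.
have int1 (c : R) (h : set R) d0 (S : measurableType d0) :
    (fun=> c : R) @^-1` h = (if c \in h then setT else set0) :> set S.
  by case: ifPn => [/set_mem hc|/negP hc]; apply/seteqP; split => // x hx;
    case: hc; exact/mem_set.
have -> : \int[P]_w f w = \int[P']_w f' w.
  have := @eq_integral_mul _ _ P _ _ P' f (fun=> 1) f' (fun=> 1).
  under eq_Rintegral do rewrite mulr1.
  under [in RHS]eq_Rintegral do rewrite mulr1.
  apply=> //; try exact: Lfun2_cst.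
  move=> A B mA mB; rewrite !int1; case: ifP => _; last by rewrite !setI0 !measure0.
  by have := PP' A setT mA measurableT; rewrite !preimage_setT !setIT.
have -> // : \int[P]_w g w = \int[P']_w g' w.
have := @eq_integral_mul _ _ P _ _ P' g (fun=> 1) g' (fun=> 1).
under eq_Rintegral do rewrite mulr1.
under [in RHS]eq_Rintegral do rewrite mulr1.
apply=> //; try exact: Lfun2_cst.
move=> A B mA mB; rewrite !int1; case: ifP => _; last by rewrite !setI0 !measure0.
by have := PP' setT A measurableT mA; rewrite !preimage_setT !setTI !setIT.
Qed.

(** The law of the pair is the product of the marginal laws, to which Fubini's
    theorem applies. *)
Lemma cov_indep d (T : measurableType d) (P : probability T R) (f g : T -> R) :
  f \in Lfun P 2%:E -> g \in Lfun P 2%:E ->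
  (forall A B : set R, measurable A -> measurable B ->
    P (f @^-1` A `&` g @^-1` B) = (P (f @^-1` A) * P (g @^-1` B))%E) ->
  cov P f g = 0.
Proof.
move=> f2 g2 Pfg; rewrite covE//.
have mf := measurable_Lfun2 f2; have mg := measurable_Lfun2 g2.
suff -> : \int[P]_w (f w * g w) = (\int[P]_w f w) * \int[P]_w g w by rewrite subrr.
rewrite /Rintegral (integral_joint mf mg (Lfun2_integrable_mul f2 g2)).
have mT (h : T -> R) : measurable_fun setT h ->
  @measurable_fun _ _ T (measurableTypeR R) setT h by [].
pose fm : {mfun T >-> measurableTypeR R} :=
  HB.pack f (isMeasurableFun.Build _ _ T (measurableTypeR R) f (mT f mf)).
pose gm : {mfun T >-> measurableTypeR R} :=
  HB.pack g (isMeasurableFun.Build _ _ T (measurableTypeR R) g (mT g mg)).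
pose m1 := distribution P fm; pose m2 := distribution P gm.
have fgE C : measurable C -> distribution P (joint_mfun mf mg) C = (m1 \x m2)%E C.
  move=> mC; apply/esym/product_measure_unique => // A B mA mB; exact: Pfg.
rewrite (eq_measure_integral (m1 \x m2)%E); last by move=> C mC _; exact: fgE.
have mid : measurable_fun setT (fun x : measurableTypeR R => x%:E).
  exact/measurable_EFinP.
have If : (\int[m1]_x x%:E = \int[P]_w (f w)%:E)%E.
  by rewrite integral_distribution//; exact: Lfun2_integrable.
have Ig : (\int[m2]_x x%:E = \int[P]_w (g w)%:E)%E.
  by rewrite integral_distribution//; exact: Lfun2_integrable.
have i1 : m1.-integrable setT (fun x => x%:E).
  apply/integrableP; split => //.
  rewrite ge0_integral_distribution//; last exact: measurableT_comp.
  by have /integrableP[] := Lfun2_integrable f2.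
have i2 : m2.-integrable setT (fun x => x%:E).
  apply/integrableP; split => //.
  rewrite ge0_integral_distribution//; last exact: measurableT_comp.
  by have /integrableP[] := Lfun2_integrable g2.
have i12 : (m1 \x m2)%E.-integrable setT (fun z : R2 => (z.1 * z.2)%:E).
  apply/integrableP; split; first exact: measurable_mul2.
  rewrite (eq_measure_integral (distribution P (joint_mfun mf mg))); last first.
    by move=> C mC _; exact: (esym (fgE C mC)).
  rewrite ge0_integral_distribution//; last first.
    by apply: measurableT_comp => //; exact: measurable_mul2.
  by have /integrableP[] := Lfun2_integrable_mul f2 g2.
rewrite -integral12_prod_meas1// /fubini_F/=.
under eq_integral => x _.
  under eq_integral do rewrite EFinM.
  rewrite integralZl// Ig.
  over.
have Ggfin : (\int[P]_w (g w)%:E)%E \is a fin_num.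
  by apply: integrable_fin_num => //; exact: Lfun2_integrable.
have Iffin : (\int[P]_w (f w)%:E)%E \is a fin_num.
  by apply: integrable_fin_num => //; exact: Lfun2_integrable.
rewrite -(fineK Ggfin) integralZr//= If.
by rewrite -{1}(fineK Iffin).
Qed.

End joint_laws.

(** * Mixed fractional Brownian motion *)

Section mixed_noise.
Context {R : realType} d (T : measurableType d) (P : probability T R).
Implicit Types (B W : R -> {mfun T >-> R}).

Definition fBm_cov (h x y : R) : R :=
  (x `^ (2 * h) + y `^ (2 * h) - `|y - x| `^ (2 * h)) / 2.

Lemma mixed_noise_Lfun2 (sigma H : R) B W t : driving_noise P H B W -> 0 <= t ->
  (fun w => sigma * B t w + W t w) \in Lfun P 2%:E.
Proof.
move=> [[gB _ _] [gW _ _] _] t0.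
by apply: Lfun2D; [apply: Lfun2Z|]; exact: centered_gaussian_process_Lfun2.
Qed.

Lemma cov_mixed_noise (sigma H : R) B W s t : driving_noise P H B W ->
  0 <= s -> 0 <= t ->
  cov P (fun w => sigma * B s w + W s w) (fun w => sigma * B t w + W t w)
  = sigma ^+ 2 * fBm_cov H s t + Num.min s t.
Proof.
move=> [[gB _ cB] [gW _ cW] BW] s0 t0.
have Bs := centered_gaussian_process_Lfun2 s0 gB.
have Bt := centered_gaussian_process_Lfun2 t0 gB.
have Ws := centered_gaussian_process_Lfun2 s0 gW.
have Wt := centered_gaussian_process_Lfun2 t0 gW.
have ev (Z : R -> {mfun T >-> R}) u (A : set R) : 0 <= u -> measurable A ->
    process_events Z (Z u @^-1` A).
  by move=> u0 mA; apply: sub_sigma_algebra; exists u, A.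
have BW0 u v : 0 <= u -> 0 <= v -> cov P (B u) (W v) = 0.
  move=> u0 v0; apply: cov_indep; [exact: centered_gaussian_process_Lfun2..|].
  by move=> A C mA mC; apply: BW; exact: ev.
rewrite covDl ?Lfun2D ?Lfun2Z// covZl ?Lfun2D ?Lfun2Z//.
rewrite !(covC P _ (fun w => _ + _)) !covDl ?Lfun2Z// !covZl//.
rewrite (covC P (W t)) !BW0// (covC P (B t)) (covC P (W t)).
by rewrite {1}/cov cB// {1}/cov cW//= /fBm_cov; ring.
Qed.

End mixed_noise.

Section parameter_derivatives.
Context {R : realType}.

Lemma exists_is_derive_mx m n (S S' : R -> 'M[R]_(m, n)) (x : R) :
  (\near x, S' x = S x) -> (forall i j, derivable (fun s => S' s i j) x 1) ->
  exists dS, is_derive_mx S x dS.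
Proof.
move=> SS' dS'; exists (\matrix_(i, j) 'D_1 (fun s => S' s i j) x) => i j.
apply: (@is_derive_near_eq _ (fun s => S' s i j)).
  by apply: filterS SS' => s ->.
by rewrite mxE; apply: DeriveDef => //; exact: dS'.
Qed.

(** In both models the fractional part [A] of the covariance is multiplied by
    [s ^+ 2] and depends on [h], whereas the Brownian part [B] is constant. *)
Lemma regular_covariance_decomposition n (S : R -> R -> 'M[R]_n) (sigma h : R)
    (A : R -> 'M[R]_n) (B : 'M[R]_n) :
  0 < sigma -> 1 / 2 < h < 1 ->
  (forall s h, 0 < s -> 1 / 2 < h < 1 -> S s h = s ^+ 2 *: A h + B) ->
  (forall s h (x : 'cV[R]_n), 0 < s -> 1 / 2 < h < 1 ->
    0 <= (x^T *m S s h *m x) 0 0) ->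
  (forall i j, derivable (fun h => A h i j) h 1) ->
  (A h)^T = A h -> posdefmx B -> regular_covariance S sigma h.
Proof.
move=> s0 h12 SE Spsd dA At Bpos; split.
- apply: (exists_is_derive_mx (S' := fun s => s ^+ 2 *: A h + B)).
    near=> s; rewrite SE//; near: s; exact: lt_nbhsr.
  move=> i j; rewrite (_ : (fun s => _) = fun s : R => s ^+ 2 * A h i j + B i j).
    exact: ex_derive.
  by apply/funext => s; rewrite !mxE.
- apply: (exists_is_derive_mx (S' := fun x => sigma ^+ 2 *: A x + B)).
    case/andP: h12 => h1 h2.
    near=> x; rewrite SE//; apply/andP; split.
      by near: x; exact: lt_nbhsr.
    by near: x; exact: lt_nbhsl.
  move=> i j; rewrite (_ : (fun x => _) = fun x : R => sigma ^+ 2 * A x i j + B i j).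
    apply: derivableD; last exact: derivable_cst.
    by apply: derivableM; [exact: derivable_cst | exact: dA].
  by apply/funext => s; rewrite !mxE.
- rewrite SE//; apply: posdef_addl => // s x s'0.
  by rewrite -SE//; exact: Spsd.
Unshelve. all: by end_near. Qed.

End parameter_derivatives.

Section mfBm_covariance.
Context {R : realType} d (T : measurableType d).
Variables (P : R -> R -> probability T R) (Y : R -> R -> R -> {mfun T >-> R}).
Hypothesis mY : forall s h : R, 0 < s -> 0 < h < 1 -> mfBm (P s h) s h (Y s h).
Variables (D : R) (n : nat).
Hypothesis D0 : 0 < D.

Let time (j : nat) : R := j%:R * D.

Let time_ge0 j : 0 <= time j.
Proof. by rewrite mulr_ge0// ltW. Qed.

Definition increment_cov (K : R -> R -> R) (j k : nat) : R :=
  K (j.+1%:R * D) (k.+1%:R * D) - K (j.+1%:R * D) (k%:R * D)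
  - (K (j%:R * D) (k.+1%:R * D) - K (j%:R * D) (k%:R * D)).

(** Increments of a Brownian motion over disjoint intervals are uncorrelated. *)
Lemma increment_cov_min j k : increment_cov Num.min j k = D *+ (j == k).
Proof.
have minE a b : Num.min (a%:R * D) (b%:R * D) = (minn a b)%:R * D.
  case: (leqP a b) => [ab|/ltnW ba].
    by rewrite min_l// ler_pM2r// ler_nat.
  by rewrite min_r// ler_pM2r// ler_nat.
rewrite /increment_cov !minE -[D *+ _]mulr_natl.
have -> : (j == k :> nat)%:R = (minn j.+1 k.+1 + minn j k)%:R
    - (minn j.+1 k + minn j k.+1)%:R :> R.
  apply/eqP; rewrite eq_sym subr_eq -natrD; apply/eqP; congr _%:R.
  by case: (ltngtP j k) => /= jk; lia.
by rewrite !natrD; ring.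
Qed.

Let data_Lfun2 s h (j : nat) : 0 < s -> 0 < h < 1 ->
  (fun w => Y s h (time j) w) \in Lfun (P s h) 2%:E.
Proof.
move=> s0 h01; have [B [W [BW YE]]] := mY s0 h01.
under eq_fun do rewrite YE//; exact: mixed_noise_Lfun2 BW _.
Qed.

Let incr_Lfun2 s h (j : 'I_n) : 0 < s -> 0 < h < 1 ->
  (fun w => mfBm_data (Y s h) D n w j 0) \in Lfun (P s h) 2%:E.
Proof.
move=> s0 h01; under eq_fun do rewrite mxE.
by apply: Lfun2B; exact: data_Lfun2.
Qed.

Let Sigma_mE s h : 0 < s -> 0 < h < 1 ->
  Sigma_m P Y D n s h
  = s ^+ 2 *: (\matrix_(j, k) increment_cov (fBm_cov h) j k) + D%:M.
Proof.
move=> s0 h01; have [B [W [BW YE]]] := mY s0 h01.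
apply/matrixP => j k; rewrite mxE -/(cov _ _ _).
have N2 (i : nat) := data_Lfun2 i s0 h01.
have covY (i l : nat) : cov (P s h) (fun w => Y s h (time i) w)
    (fun w => Y s h (time l) w)
    = s ^+ 2 * fBm_cov h (time i) (time l) + Num.min (time i) (time l).
  rewrite -(cov_mixed_noise s BW)//.
  by congr cov; apply/funext => w; rewrite YE.
have -> : cov (P s h) (fun w => mfBm_data (Y s h) D n w j 0)
    (fun w => mfBm_data (Y s h) D n w k 0)
    = increment_cov (fun x y => s ^+ 2 * fBm_cov h x y + Num.min x y) j k.
  under [X in cov _ X]eq_fun do rewrite mxE.
  under [X in cov _ _ X]eq_fun do rewrite mxE.
  by rewrite (covBB (N2 j.+1) (N2 j) (N2 k.+1) (N2 k)) !covY.
rewrite !mxE /increment_cov.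
rewrite -(increment_cov_min j k) /increment_cov; ring.
Qed.

Let Sigma_m_psd s h (x : 'cV[R]_n) : 0 < s -> 0 < h < 1 ->
  0 <= (x^T *m Sigma_m P Y D n s h *m x) 0 0.
Proof.
move=> s0 h01; have := @cov_psd _ _ _ (P s h) _
  (fun i w => mfBm_data (Y s h) D n w i 0) x (fun i => incr_Lfun2 i s0 h01).
exact.
Qed.

Lemma derivable_fBm_cov (h x y : R) : 0 < h -> 0 <= x -> 0 <= y ->
  derivable (fun z : R => fBm_cov z x y) h 1.
Proof.
move=> h0 x0 y0; have dp (u : R) : 0 <= u ->
  derivable (fun z : R => u `^ (2 * z) : R) h 1.
  by move=> u0; have [] := is_derive_powR_exponent u0 h0.
apply: derivableM; last exact: derivable_cst.
apply: derivableB; last exact: dp.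
by apply: derivableD; exact: dp.
Qed.

Lemma regular_Sigma_m sigma h : 0 < sigma -> 1 / 2 < h < 1 ->
  regular_covariance (Sigma_m P Y D n) sigma h.
Proof.
have h01 (x : R) : 1 / 2 < x < 1 -> 0 < x < 1.
  by case/andP => x1 ->; rewrite andbT; apply: lt_trans x1; lra.
move=> s0 h12; apply: (@regular_covariance_decomposition _ _ _ _ _
    (fun h => \matrix_(j, k) increment_cov (fBm_cov h) j k) D%:M) => //.
- by move=> s x s'0 /h01; exact: Sigma_mE.
- by move=> s x v s'0 /h01; exact: Sigma_m_psd.
- move=> j k; under eq_fun do rewrite mxE.
  have /andP[h0 _] := h01 _ h12.
  by apply: derivableB; apply: derivableB;
    apply: derivable_fBm_cov => //; exact: time_ge0.
- apply/matrixP => j k; rewrite !mxE /increment_cov.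
  have sym x y : fBm_cov h x y = fBm_cov h y x.
    by rewrite /fBm_cov distrC [x `^ _ + _]addrC.
  rewrite (sym (k.+1%:R * D)) (sym (k.+1%:R * D) (j%:R * D)).
  by rewrite (sym (k%:R * D)) (sym (k%:R * D) (j%:R * D)); ring.
- split=> [|x x0]; first exact: tr_scalar_mx.
  have [i xi0] : exists i, x i 0 != 0.
    apply: contrapT => /forallNP x00; case/negP: x0; apply/eqP/colP => i.
    by rewrite mxE; apply: contrapT => /eqP/x00.
  rewrite -mulmxA mul_scalar_mx -scalemxAr mxE mulr_gt0// mxE.
  rewrite (bigD1 i)//= ltr_pwDl ?sumr_ge0// => [|j _].
    by rewrite mxE -expr2 lt_def sqr_ge0 sqrf_eq0 xi0.
  by rewrite mxE -expr2 sqr_ge0.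
Qed.

End mfBm_covariance.

(** * Integrals of continuous paths *)

Section joint_measurability.
Context {R : realType} d (T : measurableType d).
Variable X : R -> {mfun T >-> R}.
Hypothesis cX : continuous_paths X.
Local Notation RR := (measurableTypeR R).

Lemma continuous_max0 (f : R -> R) : {within `[0, +oo[, continuous f} ->
  continuous (fun z : R => f (Num.max 0 z)).
Proof.
move=> /subspace_continuousP cf z.
have m0 : `[0, +oo[%classic (Num.max 0 z) by rewrite /= in_itv/= andbT le_max lexx.
apply: (cvg_comp _ _ _ (cf _ m0)) => A /= wA.
have cm : continuous (fun z : R => Num.max 0 z).
  by move=> x; apply: continuous_max; [exact: cvg_cst | exact: cvg_id].
have := cm z _ wA; apply: (@filterS _ (nbhs z)) => x /=; apply.
by rewrite /= in_itv/= andbT le_max lexx.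
Qed.

Let grid (n : nat) (u : R) : R := (Num.truncn (Num.max 0 u * n.+1%:R))%:R / n.+1%:R.

Let grid_ge0 n u : 0 <= grid n u.
Proof. by rewrite divr_ge0. Qed.

Let cvg_grid u : grid n u @[n --> \oo] --> Num.max 0 u.
Proof.
apply/cvgrPdist_le => e e0; near=> n.
have m0 : 0 <= Num.max 0 u * n.+1%:R by rewrite mulr_ge0// le_max lexx.
have /andP[t1 t2] := truncn_itv m0.
have n0 : 0 < n.+1%:R :> R by [].
rewrite /grid -[X in `|X - _|](mulfK (lt0r_neq0 n0)) -mulrBl normrM.
rewrite [X in _ * X]ger0_norm ?invr_ge0// ger0_norm ?subr_ge0//.
rewrite ler_pdivrMr// (@le_trans _ _ 1)//.
  by move: t2; rewrite -[(Num.truncn _).+1%:R]natr1 => t2; lra.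
rewrite -ler_pdivrMr// mul1r ltW//.
by near: n; exact: (near_infty_natSinv_lt (PosNum e0)).
Unshelve. all: by end_near. Qed.

Let mX n : measurable_fun setT (fun p : T * RR => X (grid n p.2) p.1).
Proof.
move=> _ A mA; rewrite setTI.
pose S (k : nat) : set RR :=
  (fun u => Num.max 0 u * n.+1%:R) @^-1` `[k%:R, k.+1%:R[.
have -> : (fun p : T * RR => X (grid n p.2) p.1) @^-1` A
    = \bigcup_k ((X (k%:R / n.+1%:R) @^-1` A) `*` S k).
  apply/seteqP; split => [[w u] /= Xwu|[w u] [k _ [/= Xwk]]].
    exists (Num.truncn (Num.max 0 u * n.+1%:R)) => //; split => //.
    by rewrite /S/= in_itv/= truncn_itv// mulr_ge0// le_max lexx.
  rewrite /S/= in_itv/= => kP.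
  by rewrite /grid (_ : Num.truncn _ = k)//; apply: truncn_def.
apply: bigcupT_measurable => k; apply: measurableX.
  by rewrite -[X in measurable X]setTI; exact: measurable_funP.
have mm : measurable_fun setT (fun u : RR => Num.max 0 u * n.+1%:R).
  by apply: measurable_funM => //; exact: measurable_maxr.
by rewrite -[X in measurable X]setTI; exact: mm.
Qed.

(** A process with continuous paths is the pointwise limit of its
    discretizations, which are jointly measurable. *)
Lemma measurable_process :
  measurable_fun setT (fun p : T * RR => X (Num.max 0 p.2) p.1).
Proof.
apply: (measurable_fun_cvg mX) => -[w u] _ /=.
have cc := continuous_max0 (@cX w).
have h := cvg_comp _ _ (@cvg_grid u) (cc (Num.max 0 u)).
rewrite max_r ?le_max ?lexx// in h.
apply: cvg_trans h; apply: near_eq_cvg; near=> n => /=.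
by rewrite max_r.
Unshelve. all: by end_near. Qed.

End joint_measurability.

Section path_integral.
Context {R : realType} d (T : measurableType d) (P : probability T R).
Local Notation mu := (@lebesgue_measure R).
Local Notation RR := (measurableTypeR R).
Variables (X : R -> {mfun T >-> R}) (K : R).
Hypothesis cX : continuous_paths X.
Hypothesis X2 : forall t : R, 0 <= t -> (X t : T -> R) \in Lfun P 2%:E.
Hypothesis XK : forall t : R, 0 <= t -> \int[P]_w (X t w * X t w) <= K.

Definition path_integral (t : R) (w : T) : R := \int[mu]_(u in `[0, t]) X u w.

Lemma integrable_path (t : R) w : mu.-integrable `[0, t] (EFin \o (fun u => X u w)).
Proof.
apply: continuous_compact_integrable; first exact: segment_compact.
apply: (continuous_subspaceW (A := `[0, t]) (B := `[0, +oo[)); last exact: cX.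
by move=> u /=; rewrite !in_itv/= => /andP[->].
Qed.

Section pairing.
Variables (Y : T -> R) (t : R).
Hypothesis Y2 : Y \in Lfun P 2%:E.

Let f (p : T * RR) : \bar R :=
  ((X (Num.max 0 p.2) p.1 * Y p.1) * \1_(`[0, t]%classic : set R) p.2)%:E.

Let mindic : measurable_fun setT (\1_(`[0, t]%classic : set RR) : RR -> R).
Proof. exact: measurable_indic. Qed.

Let mf : measurable_fun setT f.
Proof.
apply/measurable_EFinP; apply: measurable_funM; first apply: measurable_funM.
- exact: measurable_process.
- by apply: measurableT_comp => //; exact: measurable_Lfun2 Y2.
- exact: (measurableT_comp mindic measurable_snd).
Qed.

Let fE w u : f (w, u) = ((EFin \o (fun u => X u w * Y w)) \_ `[0, t]) u.
Proof.
rewrite /f/= patchE indicE; case: ifPn => [|_]; last by rewrite mulr0.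
by rewrite inE/= in_itv/= => /andP[u0 _]; rewrite mulr1 max_r.
Qed.

(* By Young's inequality, C bounds the expectation of |X u * Y| for u >= 0. *)
Let C := (K + \int[P]_w (Y w * Y w)) / 2.

Let C0 : 0 <= C.
Proof.
rewrite divr_ge0// addr_ge0//; last by apply: Rintegral_ge0 => w _; exact: sqr_ge0.
by apply: le_trans (XK (lexx 0)); apply: Rintegral_ge0 => w _; exact: sqr_ge0.
Qed.

Let slice_le u : (\int[P]_w `|f (w, u)| <= (C * \1_(`[0, t]%classic : set R) u)%:E)%E.
Proof.
under eq_integral do rewrite fE patchE.
rewrite indicE; case: (boolP (u \in _)) => [|_]; last first.
  by rewrite mulr0 integral0_eq// => w _; rewrite abse0.
rewrite inE/= in_itv/= => /andP[u0 _]; rewrite mulr1.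
have Xu2 := X2 u0; have iXY := Lfun2_integrable_mul Xu2 Y2.
have iXX := Lfun2_integrable_mul Xu2 Xu2.
have iYY := Lfun2_integrable_mul Y2 Y2.
have iabs : P.-integrable setT (EFin \o (fun w => `|X u w * Y w|)).
  exact: integrable_norm iXY.
rewrite [leLHS](_ : _ = (\int[P]_w `|X u w * Y w|)%:E); last first.
  by rewrite /Rintegral fineK// integrable_fin_num.
rewrite lee_fin /C.
apply: (@le_trans _ _ (\int[P]_w ((X u w * X u w + Y w * Y w) * 2^-1))).
  apply: le_Rintegral => //.
    have := @integrableZr _ _ _ P setT _ 2^-1 _ (integrableD _ iXX iYY); exact.
  move=> w _; rewrite normrM.
  have := sqr_ge0 (`|X u w| - `|Y w|).
  rewrite sqrrB !real_normK ?num_real// !expr2; lra.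
rewrite RintegralZr//; last exact: (integrableD _ iXX iYY).
rewrite RintegralD// ler_pM2r ?invr_gt0// lerD2r.
exact: XK.
Qed.

Let mbound : measurable_fun setT
  (fun u : RR => (C * \1_(`[0, t]%classic : set R) u)%:E).
Proof.
apply/measurable_EFinP.
exact: (measurable_funM (measurable_cst (C : R)) mindic).
Qed.

Let bound_lty : (\int[mu]_u (C * \1_(`[0, t]%classic : set R) u)%:E < +oo)%E.
Proof.
under eq_integral do rewrite EFinM.
rewrite ge0_integralZl//; last first.
  by apply/measurable_EFinP;
    exact: mindic.
rewrite integral_indic//= setIT lebesgue_measure_itv/=.
by case: ifP => _; rewrite ?mule0 ?ltry// -EFinD -EFinM ltry.
Qed.

Let intf : (P \x mu)%E.-integrable setT f.
Proof.
apply/(integrable21ltyP P mu mf).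
apply: (@le_lt_trans _ _ (\int[mu]_u (C * \1_(`[0, t]%classic : set R) u)%:E)%E).
  apply: ge0_le_integral => //.
  - by move=> u _; exact: integral_ge0.
  - have mabs : measurable_fun setT (abse \o f) by exact: measurableT_comp.
    have := @measurable_fun_fubini_tonelli_G _ _ _ _ _ P (abse \o f) mabs
      (fun=> abse_ge0 _); exact.
exact: bound_lty.
Qed.

Let sliceE u : u \in `[0, t]%classic ->
  (\int[P]_w f (w, u))%E = (\int[P]_w (X u w * Y w))%:E.
Proof.
move=> ut; under eq_integral do rewrite fE patchE ut.
rewrite /Rintegral fineK// integrable_fin_num//.
apply: Lfun2_integrable_mul => //; apply: X2.
by move: ut; rewrite inE/= in_itv/= => /andP[].
Qed.

Let slice0 u : u \notin `[0, t]%classic -> (\int[P]_w f (w, u))%E = 0%E.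
Proof.
move=> /negbTE ut; apply: integral0_eq => w _.
by rewrite fE patchE ut.
Qed.

Let sliceTE : (fun u => \int[P]_w f (w, u))%E
  = (EFin \o (fun u => \int[P]_w (X u w * Y w))) \_ `[0, t].
Proof.
apply/funext => u; rewrite patchE; case: ifPn => ut; first exact: sliceE.
exact: slice0.
Qed.

Lemma integrable_pairing :
  mu.-integrable `[0, t] (EFin \o (fun u => \int[P]_w (X u w * Y w))).
Proof.
apply/integrable_mkcond => //; rewrite -sliceTE.
have mG := measurable_fubini_G intf.
apply: (@le_integrable _ _ _ mu setT _ _
  (fun u => (C * \1_(`[0, t]%classic : set R) u)%:E)) => //; last first.
  apply/integrableP; split.
    exact: mbound.
  rewrite (eq_integral (fun u : RR => (C * \1_(`[0, t]%classic : set R) u)%:E)).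
    exact: bound_lty.
  by move=> u _; rewrite gee0_abs// lee_fin mulr_ge0 ?C0// indicE.
move=> u _; apply: le_trans (le_trans (slice_le u) (lee_abs _)).
by apply: le_abse_integral => //; exact: (measurableT_comp mf (pair2_measurable u)).
Qed.

Let pathE : (fun w => \int[mu]_u f (w, u))%E
  = EFin \o (fun w => path_integral t w * Y w).
Proof.
apply/funext => w; under eq_integral do rewrite fE.
rewrite -integral_mkcond /=.
under eq_integral do rewrite EFinM.
rewrite integralZr//; last exact: integrable_path.
rewrite EFinM; congr (_ * _)%E.
by rewrite /path_integral /Rintegral fineK// integrable_fin_num//; exact: integrable_path.
Qed.

Lemma integrable_path_integral :
  P.-integrable setT (EFin \o (fun w => path_integral t w * Y w)).
Proof. by rewrite -pathE; exact: (integrable_fubini_F intf). Qed.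

Lemma integral_path_integral :
  \int[P]_w (path_integral t w * Y w)
  = \int[mu]_(u in `[0, t]) \int[P]_w (X u w * Y w).
Proof.
have := Fubini intf; rewrite pathE sliceTE -integral_mkcond.
by move=> h; rewrite /Rintegral; congr fine.
Qed.

End pairing.

(** Fubini's theorem, with [J] a square integrable version of the path
    integral. *)
Lemma cov_path_integral (J Y : T -> R) (t : R) :
  J \in Lfun P 2%:E -> Y \in Lfun P 2%:E ->
  {ae P, forall w, J w = path_integral t w} ->
  mu.-integrable `[0, t] (EFin \o (fun u => cov P (X u) Y)) /\
  cov P J Y = \int[mu]_(u in `[0, t]) cov P (X u) Y.
Proof.
move=> J2 Y2 JI.
have one2 : (fun=> 1 : R) \in Lfun P 2%:E by exact: Lfun_cst.
have JZ (Z : T -> R) : Z \in Lfun P 2%:E ->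
    \int[P]_w (J w * Z w) = \int[mu]_(u in `[0, t]) \int[P]_w (X u w * Z w).
  move=> Z2; rewrite -integral_path_integral// /Rintegral; congr fine.
  apply: ae_eq_integral => //.
  - exact: (measurable_int _ (Lfun2_integrable_mul J2 Z2)).
  - exact: (measurable_int _ (integrable_path_integral t Z2)).
  - by apply: filterS JI => w /= -> _.
have iXY := integrable_pairing t Y2.
have iX : mu.-integrable `[0, t] (EFin \o (fun u => \int[P]_w X u w)).
  apply: eq_integrable (integrable_pairing t one2) => // u _ /=.
  by congr (_%:E); apply: eq_Rintegral => w _; rewrite mulr1.
have EJ : \int[P]_w J w = \int[mu]_(u in `[0, t]) \int[P]_w X u w.
  transitivity (\int[P]_w (J w * 1)); first by apply: eq_Rintegral => w _; rewrite mulr1.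
  rewrite (JZ _ one2); apply: eq_Rintegral => u _.
  by apply: eq_Rintegral => w _; rewrite mulr1.
have covXY : {in `[0, t]%classic, (fun u => \int[P]_w (X u w * Y w)
    - (\int[P]_w X u w) * \int[P]_w Y w) =1 (fun u => cov P (X u) Y)}.
  move=> u; rewrite inE/= in_itv/= => /andP[u0 _].
  by rewrite covE//; exact: X2.
have iXc : mu.-integrable `[0, t]
    (EFin \o (fun u => (\int[P]_w X u w) * \int[P]_w Y w)).
  have := @integrableZr _ _ _ mu `[0, t]%classic _ (\int[P]_w Y w) _ iX; exact.
split.
  apply: (@eq_integrable _ _ _ mu _ _ (EFin \o (fun u => \int[P]_w (X u w * Y w)
    - (\int[P]_w X u w) * \int[P]_w Y w))) => //.
    by move=> u ut /=; rewrite covXY.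
  have := @integrableB _ _ _ mu `[0, t]%classic _ _ _ iXY iXc; exact.
transitivity (\int[mu]_(u in `[0, t]) (\int[P]_w (X u w * Y w)
    - (\int[P]_w X u w) * \int[P]_w Y w)); last first.
  by apply: eq_Rintegral => u ut; exact: covXY.
by rewrite RintegralB// covE// JZ// EJ RintegralZr.
Qed.

End path_integral.

(** * Primitives of an even function *)

Section even_kernel.
Context {R : realType}.
Local Notation mu := (@lebesgue_measure R).
Implicit Types (f : R -> R) (a b t u x : R).

Lemma integrable_within f a b : {within `[a, b], continuous f} ->
  mu.-integrable `[a, b] (EFin \o f).
Proof.
by move=> cf; apply: continuous_compact_integrable => //; exact: segment_compact.
Qed.

Lemma continuous_within_reflect f t : 0 <= t -> {within `[0, t], continuous f} ->
  {within `[0, t], continuous (fun x => f (t - x))}.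
Proof.
move=> t0 /subspace_continuousP cf; apply/subspace_continuousP => x xt.
have rt (y : R) : `[0, t]%classic y -> `[0, t]%classic (t - y).
  by rewrite /= !in_itv/= => /andP[y0 yt]; rewrite subr_ge0 yt lerBlDr lerDl.
apply: (cvg_comp _ _ _ (cf _ (rt x xt))) => A /= wA.
have cF : {for x, continuous (fun x : R => t - x)}.
  by apply: cvgB; [exact: cvg_cst | exact: cvg_id].
have := cF _ wA; apply: (@filterS _ (nbhs x)) => y /= + yt; apply.
exact: rt.
Qed.

Lemma Rintegral_reflect f t : 0 <= t -> {within `[0, t], continuous f} ->
  \int[mu]_(x in `[0, t]) f (t - x) = \int[mu]_(x in `[0, t]) f x.
Proof.
move=> t0 cf; rewrite /Rintegral; congr fine; apply/esym.
have dF x : is_derive x 1 (fun x : R => t - x) (-1).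
  by apply: is_derive_eq; ring.
have F' : derive1 (fun x : R => t - x) = cst (-1).
  by apply/funext => x; rewrite derive1E; have [_ ->] := dF x.
have cF x : {for x, continuous (fun x : R => t - x)}.
  by apply: differentiable_continuous; apply/derivable1_diffP; have [] := dF x.
have := @integration_by_substitution_decreasing R (fun x => t - x) f 0 t t0.
rewrite subrr subr0 F' => ->//.
- by apply: eq_integral => x _; rewrite !fctE opprK mulr1.
- by move=> x y _ _ xy; rewrite ltrD2l ltrN2.
- by move=> x _; exact: cvg_cst.
- exact: is_cvg_cst.
- exact: is_cvg_cst.
- split=> [x _||]; first by have [] := dF x.
  + by apply: cvg_at_right_filter; exact: cF.
  + by apply: cvg_at_left_filter; exact: cF.
Qed.

Lemma Rintegral_translate f u t : u <= t -> {within `[0, t - u], continuous f} ->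
  \int[mu]_(x in `[u, t]) f (x - u) = \int[mu]_(x in `[0, t - u]) f x.
Proof.
move=> ut cf; rewrite /Rintegral; congr fine; apply/esym.
have dF x : is_derive x 1 (fun x : R => x - u) 1.
  by apply: is_derive_eq; ring.
have F' : derive1 (fun x : R => x - u) = cst 1.
  by apply/funext => x; rewrite derive1E; have [_ ->] := dF x.
have cF x : {for x, continuous (fun x : R => x - u)}.
  by apply: differentiable_continuous; apply/derivable1_diffP; have [] := dF x.
have := @integration_by_substitution_increasing R (fun x => x - u) f u t ut.
rewrite subrr F' => ->//.
- by apply: eq_integral => x _; rewrite !fctE mulr1.
- by move=> x y _ _ xy; rewrite ltrD2r.
- by move=> x _; exact: cvg_cst.
- exact: is_cvg_cst.
- exact: is_cvg_cst.
- split=> [x _||]; first by have [] := dF x.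
  + by apply: cvg_at_right_filter; exact: cF.
  + by apply: cvg_at_left_filter; exact: cF.
Qed.

Lemma Rintegral_split f u t : 0 <= u <= t -> {within `[0, t], continuous f} ->
  \int[mu]_(x in `[0, t]) f x
  = \int[mu]_(x in `[0, u]) f x + \int[mu]_(x in `[u, t]) f x.
Proof.
move=> /andP[u0 ut] cf; have fi := integrable_within cf.
have := @Rintegral_itvB R f (BLeft 0) (BRight t) u fi.
rewrite !bnd_simp => /(_ u0 ut) h; apply/eqP; rewrite addrC -subr_eq; apply/eqP.
rewrite h Rintegral_itv_obnd_cbnd//.
apply: (@integrableS _ _ _ mu `[0, t]) => // x /=.
by rewrite !in_itv/= => /andP[ux ->]; rewrite (le_trans u0 (ltW ux)).
Qed.

Variables (rho : R -> R) (M : R).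
Hypothesis crho : continuous rho.
Hypothesis even_rho : forall x, rho (- x) = rho x.
Hypothesis rhoM : forall x, `|rho x| <= M.

Definition prim (t : R) : R := \int[mu]_(x in `[0, t]) rho x.
Definition prim2 (t : R) : R := \int[mu]_(x in `[0, t]) prim x.

Let wrho (a b : R) : {within `[a, b], continuous rho}.
Proof. exact: continuous_subspaceT. Qed.

Lemma within_prim b : {within `[0, b], continuous prim}.
Proof.
have [b0|b0] := leP 0 b.
  exact: (parameterized_integral_continuous b0 (integrable_within (@wrho 0 b))).
rewrite set_itv_ge ?bnd_simp -?ltNge//.
by apply/subspace_continuousP => x.
Qed.

Lemma is_derive_prim t : 0 < t -> is_derive t 1 prim (rho t).
Proof.
move=> t0; have tt : t < t + 1 by rewrite ltrDl.
have [d1 d2] := continuous_FTC1_closed tt (integrable_within (@wrho 0 (t + 1)))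
  t0 (@crho t).
by apply: DeriveDef; [exact: d1 | rewrite -derive1E; exact: d2].
Qed.

Lemma is_derive_prim2 t : 0 < t -> is_derive t 1 prim2 (prim t).
Proof.
move=> t0; have tt : t < t + 1 by rewrite ltrDl.
have cp : {for t, continuous prim}.
  by apply: differentiable_continuous; apply/derivable1_diffP;
    have [] := is_derive_prim t0.
have [d1 d2] := continuous_FTC1_closed tt (integrable_within (@within_prim (t + 1)))
  t0 cp.
by apply: DeriveDef; [exact: d1 | rewrite -derive1E; exact: d2].
Qed.

Lemma prim_right0 : prim t @[t --> 0^'+] --> 0.
Proof.
apply: cvg_at_right_filter.
exact: (parameterized_integral_cvg_left ltr01 (integrable_within (@wrho 0 1))).
Qed.

Lemma prim2_right0 : prim2 t @[t --> 0^'+] --> 0.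
Proof.
apply: cvg_at_right_filter.
exact: (parameterized_integral_cvg_left ltr01 (integrable_within (@within_prim 1))).
Qed.

Lemma prim0 : prim 0 = 0. Proof. by rewrite /prim set_itv1 Rintegral_set1. Qed.

Lemma prim20 : prim2 0 = 0. Proof. by rewrite /prim2 set_itv1 Rintegral_set1. Qed.

Lemma normr_Rintegral_le f t (C : R) : 0 <= t ->
  mu.-integrable `[0, t] (EFin \o f) ->
  (forall x, 0 <= x <= t -> `|f x| <= C) ->
  `|\int[mu]_(x in `[0, t]) f x| <= C * t.
Proof.
move=> t0 fi fC; apply: le_trans (le_normr_Rintegral _ fi) _ => //.
have muE : mu `[0, t]%classic = t%:E.
  rewrite lebesgue_measure_itv/= lte_fin; case: ifPn => [_|]; first by rewrite oppr0 adde0.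
  by rewrite -leNgt => t0'; congr EFin; apply/le_anti; rewrite t0.
have -> : C * t = \int[mu]_(x in `[0, t]) C.
  by rewrite Rintegral_cst// -[t in LHS]/(fine t%:E) -muE.
apply: le_Rintegral => //.
- exact: integrable_norm fi.
- by apply: integrable_within; apply: continuous_subspaceT => x; exact: cvg_cst.
Qed.

Lemma prim_le t : 0 <= t -> `|prim t| <= M * t.
Proof.
move=> t0; apply: normr_Rintegral_le => //; exact: integrable_within (@wrho 0 t).
Qed.

Lemma prim2_le t : 0 <= t -> `|prim2 t| <= M * t * t.
Proof.
move=> t0; apply: normr_Rintegral_le => //.
  exact: integrable_within (@within_prim t).
move=> x /andP[x0 xt]; apply: le_trans (prim_le x0) _.
by rewrite ler_wpM2l// (le_trans _ (rhoM 0)).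
Qed.

Lemma Rintegral_rho_reflect t : 0 <= t ->
  \int[mu]_(v in `[0, t]) rho (v - t) = prim t.
Proof.
move=> t0; rewrite /prim -[RHS](Rintegral_reflect t0)//.
by apply: eq_Rintegral => v _; rewrite -even_rho opprB.
Qed.

Lemma Rintegral_rho_shift u t : 0 <= u <= t ->
  \int[mu]_(v in `[0, t]) rho (v - u) = prim u + prim (t - u).
Proof.
move=> ut; rewrite (Rintegral_split ut); last first.
  apply: continuous_subspaceT => x.
  apply: (@continuous_comp _ _ _ (fun v => v - u) rho).
    by apply: cvgB; [exact: cvg_id | exact: cvg_cst].
  exact: crho.
case/andP: ut => u0 ut.
by rewrite Rintegral_rho_reflect// Rintegral_translate.
Qed.

Lemma Rintegral_prim_sym t : 0 <= t ->
  \int[mu]_(u in `[0, t]) (prim u + prim (t - u)) = 2 * prim2 t.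
Proof.
move=> t0; rewrite RintegralD; first last.
- apply: integrable_within; apply: (continuous_within_reflect t0).
  exact: within_prim.
- exact: integrable_within (@within_prim t).
- exact: measurable_itv.
- rewrite (Rintegral_reflect t0); last exact: within_prim.
  by rewrite -/(prim2 t); ring.
Qed.

End even_kernel.

(** * Mixed fractional Ornstein-Uhlenbeck process *)

Section mixed_OU.
Context {R : realType} d (T : measurableType d) (P : probability T R).
Local Notation mu := (@lebesgue_measure R).
Variables (sigma H alpha : R) (X B W : R -> {mfun T >-> R}).
Hypotheses (alpha0 : 0 < alpha) (H0 : 0 < H).
Hypothesis BW : driving_noise P H B W.
Hypothesis gX : centered_gaussian_process P X.
Hypothesis cX : continuous_paths X.
Hypothesis sX : stationary P X.
Hypothesis eqX : {ae P, forall w, forall t, 0 <= t ->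
  X t w = X 0 w - alpha * (\int[mu]_(u in `[0%R, t]) X u w)
          + (sigma * B t w + W t w) - (sigma * B 0 w + W 0 w)}.

Let X2 t : 0 <= t -> (X t : T -> R) \in Lfun P 2%:E.
Proof. by move=> t0; exact: centered_gaussian_process_Lfun2. Qed.

Let stationary2 u v (A C : set R) : 0 <= u -> 0 <= v ->
  measurable A -> measurable C ->
  P (X u @^-1` A `&` X (v + u) @^-1` C) = P (X 0 @^-1` A `&` X v @^-1` C).
Proof.
move=> u0 v0 mA mC.
pose t (i : 'I_2) : R := if i == 0 then 0 else v.
pose S (i : 'I_2) : set R := if i == 0 then A else C.
have bigcap2 (F : 'I_2 -> set T) : \bigcap_(i in [set: 'I_2]) F i = F 0 `&` F 1.
  apply/seteqP; split => [w Fw|w [F0 F1] i _]; first by split; exact: Fw.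
  have [->|i0] := eqVneq i 0; first by [].
  suff -> : i = 1 by [].
  by apply/val_inj; case: i i0 => [[|[|//]]].
have tge i : 0 <= t i by rewrite /t; case: ifP.
have mS i : measurable (S i) by rewrite /S; case: ifP.
by have := sX tge mS u0; rewrite !bigcap2 /t /S/= add0r.
Qed.

Definition acov (x : R) : R := cov P (X 0) (X `|x|).

(** Strict stationarity gives the law of the pair [(X u, X v)], hence its
    covariance. *)
Lemma cov_acov u v : 0 <= u -> 0 <= v -> cov P (X u) (X v) = acov (v - u).
Proof.
wlog uv : u v / u <= v => [hw u0 v0|].
  have [uv|/ltW vu] := leP u v; first exact: hw.
  by rewrite covC hw// /acov distrC.
move=> u0 v0; rewrite /acov ger0_norm ?subr_ge0//.
have vu : 0 <= v - u by rewrite subr_ge0.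
apply: eq_cov_law; [exact: X2|exact: X2|exact: X2|exact: X2|].
by move=> A C mA mC; rewrite -(stationary2 u0 vu mA mC) subrK.
Qed.

Let X_second_moment t : 0 <= t ->
  \int[P]_w (X t w * X t w) <= \int[P]_w (X 0 w * X 0 w).
Proof.
move=> t0; rewrite le_eqVlt; apply/orP; left; apply/eqP.
apply: eq_integral_mul; [exact: X2|exact: X2|exact: X2|exact: X2|].
move=> A C mA mC; have := stationary2 t0 (lexx 0) mA mC.
by rewrite add0r.
Qed.

Let N t w : R := sigma * B t w + W t w.

Let N2 t : 0 <= t -> N t \in Lfun P 2%:E.
Proof. by move=> t0; exact: mixed_noise_Lfun2 BW t0. Qed.

(** By the equation, [J t] is almost surely the integral of the path over
    [0, t]; written in this form it is visibly square integrable. *)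
Let J t w : R := alpha^-1 * ((N t w - N 0 w) - (X t w - X 0 w)).

Let J2 t : 0 <= t -> J t \in Lfun P 2%:E.
Proof.
by move=> t0; apply: Lfun2Z; apply: Lfun2B; apply: Lfun2B;
  rewrite ?X2 ?N2.
Qed.

Let J_path t : 0 <= t -> {ae P, forall w, J t w = path_integral X t w}.
Proof.
move=> t0; apply: filterS eqX => w /(_ t t0).
rewrite /J /N /path_integral => ->.
by field; rewrite gt_eqF.
Qed.

Let cov_J t (Y : T -> R) : 0 <= t -> Y \in Lfun P 2%:E ->
  mu.-integrable `[0, t] (EFin \o (fun u => cov P (X u) Y)) /\
  cov P (J t) Y = \int[mu]_(u in `[0, t]) cov P (X u) Y.
Proof.
move=> t0 Y2.
exact: (cov_path_integral cX X2 X_second_moment (J2 t0) Y2 (J_path t0)).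
Qed.

Definition noise_var (t : R) : R := sigma ^+ 2 * t `^ (2 * H) + t.

Let H20 : 2 * H != 0.
Proof. by rewrite mulf_neq0 ?gt_eqF. Qed.

Let cov_N t : 0 <= t ->
  cov P (fun w => N t w - N 0 w) (fun w => N t w - N 0 w) = noise_var t.
Proof.
move=> t0; rewrite (covBB (N2 t0) (N2 (lexx 0)) (N2 t0) (N2 (lexx 0))).
rewrite !(cov_mixed_noise sigma BW)// /fBm_cov /noise_var !subrr !subr0 sub0r.
rewrite normrN normr0 !powR0// ger0_norm// !minxx min_r// min_l//.
by field.
Qed.

Let acov0 : 0 <= acov 0.
Proof. by rewrite /acov normr0 cov_ge0. Qed.

(** The Cauchy-Schwarz inequality, as the two variances are equal. *)
Lemma acov_le x : `|acov x| <= acov 0.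
Proof.
have := cov_young ltr01 (X2 (lexx 0)) (X2 (normr_ge0 x)).
rewrite invr1 !mul1r !cov_acov// !subrr /acov normr0 subr0 normr_id.
by move=> /le_trans; apply; lra.
Qed.

Let cov_XJ_le u t : 0 <= u -> 0 <= t -> `|cov P (X u) (J t)| <= acov 0 * t.
Proof.
move=> u0 t0; have [ix ex] := cov_J t0 (X2 u0); rewrite covC ex.
apply: normr_Rintegral_le => // v /andP[v0 _].
by rewrite cov_acov//; exact: acov_le.
Qed.

Let cov_JJ_le t : 0 <= t -> cov P (J t) (J t) <= acov 0 * t * t.
Proof.
move=> t0; have [ix ex] := cov_J t0 (J2 t0); rewrite ex.
apply: le_trans (ler_norm _) _.
apply: normr_Rintegral_le => // v /andP[v0 _].
exact: cov_XJ_le.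
Qed.

(* X t - X 0 is the difference of N t - N 0 and alpha * J t. *)
Let increment_le t : 0 <= t ->
  acov 0 - acov t <= noise_var t + alpha ^+ 2 * (acov 0 * t * t).
Proof.
move=> t0; have Xt2 := X2 t0; have X02 := X2 (lexx 0); have Jt2 := J2 t0.
have DN2 := Lfun2B (N2 t0) (N2 (lexx 0)); have aJ2 := Lfun2Z alpha Jt2.
have XE : (fun w => X t w - X 0 w) = (fun w => (N t w - N 0 w) - alpha * J t w).
  by apply/funext => w; rewrite /J; field; rewrite gt_eqF.
have := cov_sub_le DN2 aJ2; rewrite -XE (covBB Xt2 X02 Xt2 X02) !cov_acov//.
rewrite !subrr subr0 sub0r /acov normrN -!/(acov _) cov_N//.
rewrite (covZl alpha Jt2 aJ2) (covC P (J t)) (covZl alpha Jt2 Jt2).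
have := cov_JJ_le t0; rewrite -(ler_pM2l (exprn_gt0 2 alpha0)); lra.
Qed.

Let modulus (t : R) : R := noise_var t + alpha ^+ 2 * (acov 0 * t * t).

Let continuous_modulus : continuous (fun z : R => modulus (Num.max 0 z)).
Proof.
apply: continuous_max0 => x; rewrite /modulus /noise_var.
have cid : {within `[0, +oo[, continuous (fun t : R => t)}.
  by apply: continuous_subspaceT => y; exact: cvg_id.
have ccst (c : R) : {within `[0, +oo[, continuous (fun _ : R => c)}.
  by apply: continuous_subspaceT => y; exact: cvg_cst.
apply: cvgD; first apply: cvgD.
- apply: cvgM; first exact: ccst.
  by apply: within_continuous_powR; rewrite mulr_gt0.
- exact: cid.
- apply: cvgM; first exact: ccst.
  apply: cvgM; last exact: cid.
  by apply: cvgM; [exact: ccst | exact: cid].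
Qed.

Let modulus0 : modulus 0 = 0.
Proof. by rewrite /modulus /noise_var powR0//; ring. Qed.

Let acov_modulus (l x y : R) : 0 < l ->
  `|acov x - acov y| <= (l * acov 0 + l^-1 * (2 * modulus `|(`|x| - `|y|)|)) / 2.
Proof.
move=> l0; have Xx := X2 (normr_ge0 x); have Xy := X2 (normr_ge0 y).
have X02 := X2 (lexx 0).
have -> : acov x - acov y = cov P (X 0) (fun w => X `|x| w - X `|y| w).
  by rewrite covC (covBl Xx Xy X02) !(covC P _ (X 0)).
apply: le_trans (cov_young l0 X02 (Lfun2B Xx Xy)) _.
rewrite ler_pM2r ?invr_gt0// cov_acov// subrr lerD2l ler_pM2l ?invr_gt0//.
rewrite (covBB Xx Xy Xx Xy) !cov_acov// !subrr.
have -> : acov (`|y| - `|x|) = acov `|(`|x| - `|y|)|.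
  by rewrite /acov normr_id distrC.
have -> : acov (`|x| - `|y|) = acov `|(`|x| - `|y|)| by rewrite /acov normr_id.
have := increment_le (normr_ge0 (`|x| - `|y|)); rewrite -/(modulus _); lra.
Qed.

(** The difference of two values is the covariance of [X 0] with an increment of
    [X], and the variance of a short increment is small by [increment_le]. *)
Lemma continuous_acov : continuous acov.
Proof.
move=> x; apply/cvgrPdist_le => e e0.
pose l := e / (acov 0 + 1).
have a10 : 0 < acov 0 + 1 by rewrite ltr_wpDl.
have l0 : 0 < l by rewrite divr_gt0.
have cq : modulus (Num.max 0 `|(`|x| - `|y|)|) @[y --> x] --> 0.
  have h : `|(`|x| - `|y|)| @[y --> x] --> `|(`|x| - `|x|)|.
    apply: cvg_norm; apply: cvgB; first exact: cvg_cst.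
    by apply: cvg_norm; exact: cvg_id.
  have := cvg_comp _ _ h (@continuous_modulus _).
  by rewrite subrr normr0 maxxx modulus0.
have le20 : 0 < l * e / 2 by rewrite divr_gt0// mulr_gt0.
have /cvgrPdist_le/(_ _ le20) := cq; apply: filterS => y.
rewrite sub0r normrN max_r// => q.
apply: le_trans (acov_modulus x y l0) _.
have la : l * acov 0 <= e.
  by rewrite /l -mulrA ler_piMr ?(ltW e0)// ler_pdivrMl// mulr1 lerDl.
have lq : l^-1 * (2 * modulus `|(`|x| - `|y|)|) <= e.
  rewrite ler_pdivrMl//; have := le_trans (ler_norm _) q; lra.
lra.
Qed.

Let even_acov x : acov (- x) = acov x.
Proof. by rewrite /acov normrN. Qed.

Let cov_XJ u t : 0 <= u <= t ->
  cov P (X u) (J t) = prim acov u + prim acov (t - u).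
Proof.
move=> ut; have /andP[u0 u_t] := ut; have t0 := le_trans u0 u_t.
have [_ ex] := cov_J t0 (X2 u0); rewrite covC ex.
rewrite -(Rintegral_rho_shift continuous_acov even_acov ut).
apply: eq_Rintegral => v; rewrite inE/= in_itv/= => /andP[v0 _].
by rewrite cov_acov// -even_acov opprB.
Qed.

(** Both sides of [N t - N 0 = (X t - X 0) + alpha * J t] have the same variance.
    The cross term vanishes because, by reflection of [0, t], the variables
    [X t] and [X 0] have the same covariance with [J t]. *)
Lemma acov_equation t : 0 <= t ->
  acov t = acov 0 - noise_var t / 2 + alpha ^+ 2 * prim2 acov t.
Proof.
move=> t0; have Jt2 := J2 t0; have aJ2 := Lfun2Z (- alpha) Jt2.
have Xt2 := X2 t0; have X02 := X2 (lexx 0).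
have D2 := Lfun2B Xt2 X02.
have tt : 0 <= t <= t by rewrite t0/=.
have t00 : 0 <= (0 : R) <= t by rewrite lexx.
have JJ : cov P (J t) (J t) = 2 * prim2 acov t.
  have [_ ->] := cov_J t0 Jt2.
  rewrite -(Rintegral_prim_sym continuous_acov)//.
  apply: eq_Rintegral => u; rewrite inE/= in_itv/= => ut; exact: cov_XJ.
have NE : (fun w => N t w - N 0 w) = (fun w => (X t w - X 0 w) - - alpha * J t w).
  by apply/funext => w; rewrite /J; field; rewrite gt_eqF.
have := cov_N t0; rewrite NE (covBB D2 aJ2 D2 aJ2).
rewrite (covC P (fun w => X t w - X 0 w) (fun w => - alpha * J t w)).
rewrite (covZl (- alpha) Jt2 D2) (covZl (- alpha) Jt2 aJ2).
rewrite (covC P (J t) (fun w => - alpha * J t w)) (covZl (- alpha) Jt2 Jt2) JJ.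
rewrite (covC P (J t)) (covBl Xt2 X02 Jt2) !cov_XJ// subrr subr0 prim0.
rewrite (covBB Xt2 X02 Xt2 X02) !cov_acov// !subrr subr0 sub0r even_acov => <-.
by field.
Qed.

(** The autocovariance is bounded, so it is the bounded solution of
    [acov_equation]. *)
Lemma acovE t : 0 <= t -> acov t = langevin_cov alpha noise_var t.
Proof.
move=> t0.
apply: (@bounded_solutionE _ alpha noise_var acov (prim acov) (prim2 acov)
  (acov 0 * (1 + alpha))) => //.
- move=> x; rewrite /noise_var; apply: cvgD.
    apply: cvgM; last by apply: within_continuous_powR; rewrite mulr_gt0.
    by move: x; apply: continuous_subspaceT => y; exact: cvg_cst.
  by move: x; apply: continuous_subspaceT => y; exact: cvg_id.
- by move=> u u0; rewrite addr_ge0// mulr_ge0 ?sqr_ge0 ?powR_ge0.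
- by move=> u; exact: (is_derive_prim2 continuous_acov).
- by move=> u; exact: (is_derive_prim continuous_acov).
- exact: (prim2_right0 continuous_acov).
- exact: (prim_right0 continuous_acov).
- move=> u u0.
  have p1 := prim_le continuous_acov acov_le u0.
  have p2 := prim2_le continuous_acov acov_le u0.
  apply: le_trans (ler_normD _ _) _; rewrite normrM (gtr0_norm alpha0).
  have u3 : u <= 1 + u ^+ 3 /\ u * u <= 1 + u ^+ 3.
    have [u1|/ltW u1] := leP u 1.
      have u30 : 0 <= u ^+ 3 by rewrite exprn_ge0.
      have uu : u * u <= 1 by rewrite mulr_ile1.
      by split; lra.
    have u13 : u <= u ^+ 3 by rewrite ler_eXnr.
    have u23 : u ^+ 2 <= u ^+ 3 by rewrite ler_weXn2l.
    by rewrite -expr2; split; lra.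
  case: u3 => u3 u32.
  apply: (@le_trans _ _ (acov 0 * u + alpha * (acov 0 * (u * u)))).
    by rewrite lerD// ler_pM2l// mulrA.
  rewrite -mulrA mulrDl mul1r mulrDr lerD// ?ler_wpM2l//.
  by rewrite mulrCA ler_wpM2l// ler_wpM2l// ltW.
- exact: acov_equation.
- exact: prim20.
- exact: prim0.
Qed.

End mixed_OU.

Section mfOU_covariance.
Context {R : realType} d (T : measurableType d).
Variables (P : R -> R -> R -> probability T R).
Variables (X : R -> R -> R -> R -> {mfun T >-> R}).
Hypothesis oX : forall s h a : R, 0 < s -> 0 < h < 1 -> 0 < a ->
  mfOU (P s h a) s h a (X s h a).
Variables (alpha D : R) (n : nat).
Hypotheses (alpha0 : 0 < alpha) (D0 : 0 < D).

Let lag (j k : nat) : R := `|k.+1%:R * D - j.+1%:R * D|.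

Let lagE j k : lag j k = ((j - k) + (k - j))%:R * D.
Proof.
rewrite /lag -mulrBl normrM (gtr0_norm D0); congr (_ * _).
have -> : k.+1%:R - j.+1%:R = k%:R - j%:R :> R.
  by rewrite -[k.+1%:R]natr1 -[j.+1%:R]natr1; ring.
case: (leqP j k) => [jk|/ltnW kj].
  by rewrite (eqP jk) add0n natrB// ger0_norm// subr_ge0 ler_nat.
by rewrite (eqP kj) addn0 natrB// distrC ger0_norm// subr_ge0 ler_nat.
Qed.

Let data_Lfun2 s h (j : 'I_n) : 0 < s -> 0 < h < 1 ->
  (fun w => mfOU_data (X s h alpha) D n w j 0) \in Lfun (P s h alpha) 2%:E.
Proof.
move=> s0 h01; have [B [W [_ gX _ _ _]]] := oX s0 h01 alpha0.
under eq_fun do rewrite mxE.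
by apply: centered_gaussian_process_Lfun2 => //; rewrite mulr_ge0// ltW.
Qed.

Let A (h : R) : 'M[R]_n :=
  \matrix_(j, k) langevin_cov alpha (fun u => u `^ (2 * h)) (lag j k).

Let B : 'M[R]_n :=
  (2 * alpha)^-1 *: \matrix_(j, k) expR (- alpha * D) ^+ ((j - k) + (k - j)).

Let BE j k : B j k = expR (- alpha * lag j k) / (2 * alpha).
Proof.
rewrite !mxE mulrC lagE -expRM_natl; congr (expR _ / _); ring.
Qed.

Let Sigma_oE s h : 0 < s -> 1 / 2 < h < 1 ->
  Sigma_o P X D n s h alpha = s ^+ 2 *: A h + B.
Proof.
move=> s0 h12; have h01 : 0 < h < 1.
  by case/andP: h12 => h1 ->; rewrite andbT; lra.
have [Bm [Wm [BW gX cX sX eqX]]] := oX s0 h01 alpha0.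
have h0 : 0 < h by case/andP: h01.
apply/matrixP => j k; rewrite mxE -/(cov _ _ _).
under [X in cov _ X]eq_fun do rewrite mxE.
under [X in cov _ _ X]eq_fun do rewrite mxE.
have time0 (i : nat) : 0 <= i.+1%:R * D by rewrite mulr_ge0// ltW.
rewrite (cov_acov gX sX (time0 j) (time0 k)).
have -> : acov (P s h alpha) (X s h alpha) (k.+1%:R * D - j.+1%:R * D)
    = acov (P s h alpha) (X s h alpha) (lag j k).
  by rewrite /acov normr_id.
rewrite (acovE alpha0 h0 BW gX cX sX eqX (normr_ge0 _)).
have h12' : 1 / 2 <= h <= 1 by case/andP: h12 => *; rewrite !ltW.
rewrite [LHS](langevin_covD _ alpha0 _ h12').
by rewrite mxE [X in _ = _ + X]BE mxE mxE -langevin_cov_id// normr_ge0.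
Qed.

Lemma posdef_scale m (M : 'M[R]_m) (c : R) : 0 < c -> posdefmx M -> posdefmx (c *: M).
Proof.
move=> c0 [Mt Mpos]; split=> [|x x0]; first by rewrite linearZ/= Mt.
by rewrite -scalemxAr -scalemxAl mxE mulr_gt0// Mpos.
Qed.

Lemma regular_Sigma_o sigma h : 0 < sigma -> 1 / 2 < h < 1 ->
  regular_covariance (fun s h => Sigma_o P X D n s h alpha) sigma h.
Proof.
move=> s0 h12; apply: (@regular_covariance_decomposition _ _ _ _ _ A B) => //.
- move=> s x v s'0 /andP[x1 x2]; have x01 : 0 < x < 1 by rewrite x2 andbT; lra.
  have := @cov_psd _ _ _ (P s x alpha) _
    (fun i w => mfOU_data (X s x alpha) D n w i 0) v (fun i => data_Lfun2 i s'0 x01).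
  exact.
- move=> j k; under eq_fun do rewrite mxE.
  exact: (derivable_langevin_powR alpha0 (normr_ge0 _) h12).
- by apply/matrixP => j k; rewrite !mxE /lag distrC.
- apply: posdef_scale; first by rewrite invr_gt0 mulr_gt0.
  apply: posdef_ar1; rewrite expR_ge0/= expR_lt1 mulNr oppr_lt0.
  exact: mulr_gt0.
Qed.

End mfOU_covariance.

(** * The transformation of the scores *)

Unset Implicit Arguments.
Set Strict Implicit.

Theorem proposition8 (R : realType)
    (dM : measure_display) (Tm : measurableType dM)
    (Pm : R -> R -> probability Tm R)
    (Y : R -> R -> R -> {mfun Tm >-> R})
    (dO : measure_display) (To : measurableType dO)
    (Po : R -> R -> R -> probability To R)
    (X : R -> R -> R -> R -> {mfun To >-> R})
    (Delta : nat -> R) (sigma alpha : R)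
    (Ym : forall s h : R, 0 < s -> 0 < h < 1 -> mfBm (Pm s h) s h (Y s h))
    (Xo : forall s h a : R, 0 < s -> 0 < h < 1 -> 0 < a ->
            mfOU (Po s h a) s h a (X s h a))
    (Delta_gt0 : forall n, 0 < Delta n)
    (sigma_gt0 : 0 < sigma) (alpha_gt0 : 0 < alpha) :
  (forall (n : nat) (w : Tm),
     L_m sigma (Delta n) *m
       colv 2 [:: S_sigma_m Pm Y sigma (Delta n) n w;
                  S_H_m Pm Y sigma (Delta n) n w]
     = colv 2 [:: S_sigma_m Pm Y sigma (Delta n) n w;
                  R_H_m Pm Y sigma (Delta n) n w]) /\
  (forall (n : nat) (w : To),
     L_o sigma (Delta n) *m
       colv 3 [:: S_sigma_o Po X sigma alpha (Delta n) n w;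
                  S_H_o Po X sigma alpha (Delta n) n w;
                  S_alpha_o Po X sigma alpha (Delta n) n w]
     = colv 3 [:: S_sigma_o Po X sigma alpha (Delta n) n w;
                  R_H_o Po X sigma alpha (Delta n) n w;
                  S_alpha_o Po X sigma alpha (Delta n) n w]) /\
  [/\ critical_cov sigma \in unitmx,
      correlation (critical_cov sigma) = Num.sqrt 3 / 2,
      Num.sqrt 3 / 2 < 1 :> R,
      nondegenerate_under_limit (Pm sigma (3 / 4))
        (fun n => S_sigma_m Pm Y sigma (Delta n) n)
        (fun n => R_H_m Pm Y sigma (Delta n) n) (critical_cov sigma) &
      nondegenerate_under_limit (Po sigma (3 / 4) alpha)
        (fun n => S_sigma_o Po X sigma alpha (Delta n) n)
        (fun n => R_H_o Po X sigma alpha (Delta n) n) (critical_cov sigma)].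
Proof.
have h34 : 1 / 2 < (3 / 4 : R) < 1 by apply/andP; split; lra.
have cov_pos : 0 < critical_cov sigma 0 0 * critical_cov sigma 1 1.
  rewrite !mxE/=; apply: mulr_gt0; first have := exprn_gt0 2 sigma_gt0.
    by lra.
  by have := exprn_gt0 4 sigma_gt0; lra.
have cov_unit := critical_cov_unitmx sigma_gt0.
split; last split; last split.
- move=> n w; rewrite L_m_colv /R_H_m transformed_score_HE//.
  exact: (regular_Sigma_m Ym).
- move=> n w; rewrite L_o_colv /R_H_o transformed_score_HE//.
  exact: (regular_Sigma_o Xo).
- exact: cov_unit.
- exact: correlation_critical_cov.
- exact: sqrt3_half_lt1.
- exact: nondegenerate_of_limit.
- exact: nondegenerate_of_limit.
Qed.
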